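(* Let $K$ be a field of characteristic $0$, let $P=K[x_1,\dots,x_n]$ with $n\ge 2$, let $I\subseteq P$ be a saturated homogeneous ideal, and let $\delta\in\mathbb{N}$ with $I_\delta\ne\{0\}$. If $\mathcal{M}_{P/I}$ has $(n-1)$-maximal growth in degree $\delta$ and the $\mathcal{M}$-potential degree $k=\mathcal{M}_{P/I}(2,\delta)$ of the GCD of $I_\delta$ satisfies $k\ge1$, then $\langle I_{\le\delta}\rangle=\langle I_{\le\delta+1}\rangle$, this ideal is saturated, and it has a GCD of degree $k$.
   Context: $P$ has the standard grading. For a homogeneous ideal $I\subseteq P$, the sectional matrix of $P/I$ is the function $\mathcal{M}_{P/I}:\{1,\dots,n\}\times\mathbb{N}\to\mathbb{N}$, $\mathcal{M}_{P/I}(i,d)=\dim_K\big(P_d/(I+(L_1,\dots,L_{n-i}))_d\big)$, where $L_1,\dots,L_{n-i}$ are generic linear forms (the value is the same for all choices of coefficients in a suitable non-empty Zariski-open set). $\mathcal{M}_{P/I}$ has $i$-maximal growth in degree $d$ if $\mathcal{M}_{P/I}(i,d+1)=\sum_{j=1}^{i}\mathcal{M}_{P/I}(j,d)$. If $I_\delta\ne\{0\}$, the $\mathcal{M}$-potential degree of the GCD of $I_\delta$ is defined to be $\mathcal{M}_{P/I}(2,\delta)$. A homogeneous ideal $I$ is saturated if $(I:\mathfrak{m})=I$, where $\mathfrak{m}=(x_1,\dots,x_n)$. $\langle I_{\le\delta}\rangle$ denotes the ideal of $P$ generated by the homogeneous elements of $I$ of degree $\le\delta$. The GCD of an ideal is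 the greatest common divisor (up to a nonzero scalar) of all its elements. *)

(* Defs.v *)
From HB Require Import structures.
From mathcomp Require Import all_boot all_order all_algebra.
From mathcomp Require Export mpoly.
From Stdlib Require Import ClassicalEpsilon.

Set Implicit Arguments.
Unset Strict Implicit.
Unset Printing Implicit Defensive.

Import GRing.Theory.
Local Open Scope ring_scope.

Section Ideals.
Variable R : comNzRingType.
Implicit Types (S I J : R -> Prop) (p g h : R).

(* The ideals of [mathcomp.algebra.ring_quotient] are decidable and proper;
   here an ideal is an arbitrary predicate, and the unit ideal is allowed. *)
Definition is_ideal I : Prop :=
  [/\ I 0, (forall p q, I p -> I q -> I (p + q))
    & (forall p q, I q -> I (p * q))].

Definition ideal_gen S : R -> Prop := fun p =>
  exists2 s : seq (R * R), (forall u, u \in s -> S u.2)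
                         & p = \sum_(u <- s) u.1 * u.2.

Definition ideal_add I J : R -> Prop := fun p =>
  exists a b, [/\ I a, J b & p = a + b].

Definition ideal_colon I J : R -> Prop := fun p =>
  forall q, J q -> I (p * q).

Definition divides g p : Prop := exists q, p = q * g.

Definition is_gcd I g : Prop :=
  (forall p, I p -> divides g p) /\
  (forall h, (forall p, I p -> divides h p) -> divides h g).

End Ideals.

Section Graded.
Variables (K : fieldType) (n : nat).
Local Notation P := {mpoly K[n]}.
Implicit Types I J : P -> Prop.

Definition homogeneous_ideal I : Prop :=
  is_ideal I /\ forall p d, I p -> I (pihomog mdeg d p).

Definition irrelevant_ideal : P -> Prop :=
  ideal_gen (fun p : P => exists i : 'I_n, p = 'X_i).

Definition saturated I : Prop :=
  forall p, ideal_colon I irrelevant_ideal p <-> I p.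

Definition truncation_ideal I (delta : nat) : P -> Prop :=
  ideal_gen (fun p : P => I p /\ exists2 d, (d <= delta)%N & p \is d.-homog).

(* [quotient_dim J d m] says that P_d / J_d has dimension m: it is isomorphic
   to K^m, i.e. J_d is the kernel of a linear map from P_d onto K^m. *)
Definition quotient_dim J (d m : nat) : Prop :=
  exists2 f : {linear dhomog n K d -> 'rV[K]_m},
    (forall v, exists p, f p = v)
  & (forall p, f p = 0 <-> J (mpoly_of_dhomog p)).

(* The coefficients of r linear forms in n variables are the rows of an
   r x n matrix, i.e. a point of the affine space K^(r * n). *)
Definition zariski_open r (U : 'M[K]_(r, n) -> Prop) : Prop :=
  exists S : {mpoly K[r * n]} -> Prop,
    forall A, U A <-> exists2 F, S F & F.@[fun e => mxvec A ord0 e] != 0.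

Definition generically r (Q : 'M[K]_(r, n) -> Prop) : Prop :=
  exists U, [/\ zariski_open U, (exists A, U A) & forall A, U A -> Q A].

Definition linear_forms_ideal r (A : 'M[K]_(r, n)) : P -> Prop :=
  ideal_gen (fun p : P => exists j : 'I_r, p = \sum_(k < n) A j k *: 'X_k).

(* For an infinite field K, a homogeneous ideal I and 1 <= i <= n, there is
   exactly one value m with the stated property. *)
Definition sectional_matrix I (i d : nat) : nat :=
  epsilon (inhabits 0%N) (fun m : nat =>
    generically (fun A : 'M[K]_(n - i, n) =>
      quotient_dim (ideal_add I (linear_forms_ideal A)) d m)).

Definition maximal_growth I (i d : nat) : Prop :=
  sectional_matrix I i d.+1 = (\sum_(1 <= j < i.+1) sectional_matrix I j d)%N.

End Graded.

(* Main.v *)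
Require Import Defs.
From HB Require Import structures.
From mathcomp Require Import all_boot all_order all_algebra.
From mathcomp Require Import ring zify.
From Stdlib Require Import Classical.

Set Implicit Arguments.
Unset Strict Implicit.
Unset Printing Implicit Defensive.

Import GRing.Theory.
Local Open Scope ring_scope.

(** Write [P] for the polynomial ring, [N] for the ideal generated by the forms of
    [I] of degree at most [delta], and [L_0, ..., L_{n-1}] for generic linear
    forms, used as coordinates.

    Multiplication by [L_t] on [P / (I + (L_0, ..., L_{t-1}))] bounds each entry
    of the sectional matrix in degree [delta + 1] by entries in degree [delta],
    and [(n-1)]-maximal growth says that all these bounds with [t >= 1] are
    attained.  So [L_t] is a nonzerodivisor on that quotient in degree [delta]
    for [t >= 1]; for [t = 0] the same holds because [I] is saturated
    ([saturated_regular]).  This is [exists_regular_flag].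

    In these coordinates regularity in degree [d] of all the variables means that
    the intersection of [N_{d+1}] with [(X_0, ..., X_{r-1})] is
    [X_0 N_d + ... + X_{r-1} N_d] for every [r].  If this holds in degree [d] and
    [N] is generated in degrees at most [d + 1], it holds in degree [d + 1] as
    well, by trading higher variables for lower ones ([shallow_succ]); this is the
    criterion of Bayer and Stillman for regularity in the sense of Castelnuovo and
    Mumford.  Taking [r = n] in degree [delta], where [I] and [N] agree, gives
    that [I] has no new generators in degree [delta + 1].  Since [X_0] is a
    nonzerodivisor modulo [N] from degree [delta] on, and since [N] agrees with [I]
    up to degree [delta], [N] is saturated.

    For the greatest common divisor, let [y] be the last coordinate.  Restricting
    [N] to the plane of the last two coordinates and dehomogenising gives an ideal
    of [K[y]] with quotient of dimension [k] ([dehom_generator]).  By regularity a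
    nonzero element of [N] of some degree in [y] yields, after cancelling the
    earlier variables one at a time, a nonzero element in that plane of no larger
    degree in [y]; so the degrees in [y] of nonzero elements of [N] are at least
    [k] ([size_muni_ge]).  On the other hand [N] contains a form that is monic in
    [y], and the Gauss lemma over the factorial ring of polynomials in the other
    variables turns an element of [N] of least degree in [y] into a common divisor
    of [N] that is monic in [y] up to a constant ([exists_gcd]).  It is the
    greatest one, and its degree is at most [k] since its restriction divides
    the generator of the ideal of [K[y]]. *)

(** * Unique factorisation and the Gauss lemma *)

Lemma least_nat (Q : nat -> Prop) :
  (exists d, Q d) -> exists2 d, Q d & forall e, Q e -> (d <= e)%N.
Proof.
move=> [d Qd]; apply: NNPP => noleast.
suff noQ : forall b c, (c < b)%N -> ~ Q c by exact: (noQ d.+1 d).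
elim=> // b IHb c; rewrite ltnS leq_eqVlt => /orP[/eqP-> Qb|]; last exact: IHb.
apply: noleast; exists b => // e Qe.
by rewrite leqNgt; apply/negP => /IHb.
Qed.

Section Divisibility.
Variable R : comNzRingType.

Lemma divides_refl (a : R) : divides a a.
Proof. by exists 1; rewrite mul1r. Qed.

Lemma divides_trans (a b c : R) : divides a b -> divides b c -> divides a c.
Proof. by move=> [x ->] [y ->]; exists (y * x); rewrite mulrA. Qed.

Lemma divides_mull (a b c : R) : divides a b -> divides a (c * b).
Proof. by move=> [x ->]; exists (c * x); rewrite mulrA. Qed.

Lemma divides_mulr (a b c : R) : divides a b -> divides a (b * c).
Proof. by move=> ab; rewrite mulrC; exact: divides_mull. Qed.

Lemma divides_add (a b c : R) : divides a b -> divides a c -> divides a (b + c).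
Proof. by move=> [x ->] [y ->]; exists (x + y); rewrite mulrDl. Qed.

Lemma divides_opp (a b : R) : divides a b -> divides a (- b).
Proof. by move=> [x ->]; exists (- x); rewrite mulNr. Qed.

Lemma divides_sum (a : R) (T : Type) (r : seq T) (P : pred T) (F : T -> R) :
  (forall i, P i -> divides a (F i)) -> divides a (\sum_(i <- r | P i) F i).
Proof.
move=> aF; elim/big_rec: _ => [|i b Pi ab]; first by exists 0; rewrite mul0r.
exact: divides_add (aF i Pi) ab.
Qed.

End Divisibility.

Definition prime_element (R : idomainType) (p : R) : Prop :=
  [/\ p != 0, p \isn't a GRing.unit
    & forall a b, divides p (a * b) -> divides p a \/ divides p b].

Definition factorial_ring (R : idomainType) : Prop :=
  forall a : R, a != 0 -> exists (u : R) (s : seq R),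
    [/\ u \is a GRing.unit, forall p, p \in s -> prime_element p
      & a = u * \prod_(p <- s) p].

Section Factorial.
Variable R : idomainType.
Implicit Types (c d : R) (f g : {poly R}).

Lemma dividesCP c f : divides c%:P f <-> forall i, divides c f`_i.
Proof.
split=> [[g ->] i|cf]; first by exists g`_i; rewrite coefMC.
have [h hP] : exists h : nat -> R, forall i, f`_i = h i * c.
  have [h hP] := ClassicalEpsilon.choice _ cf; by exists h.
exists (\poly_(i < size f) h i); apply/polyP => i.
rewrite coefMC coef_poly; case: ltnP => [_|szf]; first exact: hP.
by rewrite mul0r nth_default.
Qed.

Lemma prime_elementC c : prime_element c -> prime_element c%:P.
Proof.
move=> [c0 cU cP]; split; first by rewrite polyC_eq0.
  by rewrite poly_unitE size_polyC c0 /= coefC eqxx.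
move=> f g cfg; apply: NNPP => /not_or_and[/dividesCP ncf /dividesCP ncg].
(* the lowest coefficients of f and g that c does not divide, at i and j:
   c would divide the product of both, from the coefficient i + j of f g *)
have [i Hi minI] := least_nat (not_all_ex_not _ _ ncf).
have [j Hj minJ] := least_nat (not_all_ex_not _ _ ncg).
have /dividesCP /(_ (i + j)%N) := cfg; rewrite coefM.
have ltij : (i < (i + j).+1)%N by rewrite ltnS leq_addr.
rewrite (bigD1 (Ordinal ltij)) //= addKn => dvd_sum.
have dvd_rest : divides c (\sum_(k < (i + j).+1 | k != Ordinal ltij)
                              f`_k * g`_(i + j - k)).
  apply: divides_sum => k; rewrite -val_eqE /= neq_ltn => /orP[lt_ki|lt_ik].
    by apply: divides_mulr; apply: NNPP => /minI; rewrite leqNgt lt_ki.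
  by apply: divides_mull; apply: NNPP => /minJ; have := ltn_ord k; lia.
have := divides_add dvd_sum (divides_opp dvd_rest); rewrite addrK => /cP.
by case.
Qed.

Lemma divides_lead_coef c f : divides c%:P f -> divides c (lead_coef f).
Proof. by move/dividesCP; apply. Qed.

Lemma prime_divides_prod (p : R) (s : seq R) :
  prime_element p -> divides p (\prod_(a <- s) a) ->
  exists2 a, a \in s & divides p a.
Proof.
move=> [p0 pU pP]; elim: s => [|a s IHs].
  by rewrite big_nil => -[x x1]; case/negP: pU; apply/unitrPr; exists x; rewrite mulrC.
rewrite big_cons => /pP[pa|/IHs[b bs pb]]; first by exists a; rewrite ?mem_head.
by exists b; rewrite // in_cons bs orbT.
Qed.

(** The primes of [c] can be cancelled one by one against [a] or [p], since a
    prime constant stays prime among polynomials. *)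
Lemma gauss (Rfact : factorial_ring R) c f (a p : {poly R}) :
  c != 0 -> c%:P * f = a * p ->
  exists c1 c2 a' p',
    [/\ c = c1 * c2, a = c1%:P * a', p = c2%:P * p' & f = a' * p'].
Proof.
move=> c0 def_f; have [u [s [Uu sP def_c]]] := Rfact c c0.
elim: s c a c0 p sP def_c def_f => [|q s IHs] c a c0 p sP def_c def_f.
  exists c, 1, (c^-1%:P * a), p.
  have Uc : c \is a GRing.unit by rewrite def_c big_nil mulr1.
  have cK : c%:P * c^-1%:P = 1 by rewrite -polyCM divrr.
  rewrite mulr1 mul1r mulrA cK mul1r -mulrA -def_f mulrA [c^-1%:P * _]mulrC cK.
  by rewrite mul1r.
have q_prime : prime_element q by apply: sP; rewrite mem_head.
have [q0 _ _] := q_prime; have [_ _ qP] := prime_elementC q_prime.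
have qX0 : q%:P != 0 by rewrite polyC_eq0.
have [d def_dE] : exists d, d = u * \prod_(b <- s) b by eexists.
have def_d : c = d * q by rewrite def_c big_cons def_dE; ring.
have d0 : d != 0 by apply: contra_neq c0 => d0; rewrite def_d d0 mul0r.
have sP' b : b \in s -> prime_element b by move=> bs; apply: sP; rewrite in_cons bs orbT.
have : divides q%:P (a * p) by exists (d%:P * f); rewrite -def_f def_d polyCM; ring.
case/qP => -[g def_g].
- have [|c1 [c2 [a' [p' [def1 def2 def3 def4]]]]] :=
    IHs d g d0 p sP' def_dE.
    by apply: (mulIf qX0); rewrite [RHS]mulrAC -def_g -def_f def_d polyCM; ring.
  exists (c1 * q), c2, a', p'; split=> //; first by rewrite def_d def1; ring.
  by rewrite def_g def2 polyCM; ring.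
- have [|c1 [c2 [a' [p' [def1 def2 def3 def4]]]]] :=
    IHs d a d0 g sP' def_dE.
    by apply: (mulIf qX0); rewrite -[RHS]mulrA -def_g -def_f def_d polyCM; ring.
  exists c1, (c2 * q), a', p'; split=> //; first by rewrite def_d def1; ring.
  by rewrite def_g def3 polyCM; ring.
Qed.

Definition primitive_poly f : Prop :=
  forall c, divides c%:P f -> c \is a GRing.unit.

(** Only the finitely many primes of the leading coefficient can divide [f], so
    it is enough to strip these, each as often as it occurs there. *)
Lemma primitive_part (Rfact : factorial_ring R) f :
  f != 0 -> exists (s : seq R) g,
    [/\ forall p, p \in s -> prime_element p, primitive_poly g
      & f = (\prod_(p <- s) p)%:P * g].
Proof.
move=> f0; have lf0 : lead_coef f != 0 by rewrite lead_coef_eq0.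
have [u [s [Uu sP def_lf]]] := Rfact _ lf0.
suff [s1 [s2 [g [perm_s def_f s2g]]]] : exists s1 s2 g,
    [/\ perm_eq s (s1 ++ s2), f = (\prod_(p <- s1) p)%:P * g
      & forall p, p \in s2 -> ~ divides p%:P g].
  have s1P p : p \in s1 -> prime_element p.
    by move=> ps; apply: sP; rewrite (perm_mem perm_s) mem_cat ps.
  exists s1, g; split=> //.
  have s1_0 : \prod_(p <- s1) p != 0.
    by apply: contra_neq f0 => s10; rewrite def_f s10 mul0r.
  have def_lg : lead_coef g = u * \prod_(p <- s2) p.
    apply: (mulfI s1_0); rewrite mulrCA -big_cat -(perm_big _ perm_s) -def_lf.
    by rewrite def_f lead_coefM lead_coefC.
  have g0 : g != 0 by apply: contra_neq f0 => g0; rewrite def_f g0 mulr0.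
  (* a nonunit constant has a prime factor, which divides the leading
     coefficient and hence is associated with some member of [s2] *)
  move=> c cg; have [|c0] := eqVneq c 0.
    move=> c0; move: cg g0 => [h ->]; by rewrite c0 mulr0 eqxx.
  have [v [[|q t] [Uv tP def_c]]] := Rfact _ c0.
    by rewrite def_c big_nil mulr1.
  have [q0 qU qP] : prime_element q by apply: tP; rewrite mem_head.
  have qc : divides q c.
    by exists (v * \prod_(b <- t) b); rewrite def_c big_cons; ring.
  have qg : divides q%:P g.
    apply: divides_trans cg; case: qc => x ->; exists x%:P; exact: polyCM.
  have := divides_lead_coef qg; rewrite def_lg => /qP[[x ux]|].
    by case/negP: qU; move: Uu; rewrite ux unitrM => /andP[].
  case/(prime_divides_prod (And3 q0 qU qP)) => b bs2 [x def_b].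
  have [b0 bU bP] : prime_element b.
    by apply: sP; rewrite (perm_mem perm_s) mem_cat bs2 orbT.
  have : divides b (x * q) by rewrite -def_b; exact: divides_refl.
  case/bP => [[y def_x]|bq].
    case/negP: qU; apply/unitrPr; exists y.
    by apply: (mulIf b0); rewrite mul1r [RHS]def_b def_x; ring.
  case: (s2g b bs2); apply: divides_trans qg.
  by case: bq => y ->; exists y%:P; rewrite polyCM.
have {u Uu def_lf} : {in s, forall p, p != 0} by move=> p /sP[].
clear sP lf0; elim: s f f0 => [|q s IHs] f f0 s0.
  by exists [::], [::], f; rewrite big_nil mul1r.
have s0' : {in s, forall p, p != 0}.
  by move=> p ps; apply: s0; rewrite in_cons ps orbT.
case: (classic (divides q%:P f)) => [[h def_f]|nqf].
  have h0 : h != 0 by apply: contra_neq f0 => h0; rewrite def_f h0 mul0r.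
  have [s1 [s2 [g [perm_s def_h s2g]]]] := IHs h h0 s0'.
  exists (q :: s1), s2, g; split=> //=; first by rewrite perm_cons.
  by rewrite big_cons def_f def_h polyCM; ring.
have [s1 [s2 [g [perm_s def_f s2g]]]] := IHs f f0 s0'.
exists s1, (q :: s2), g; split=> //.
  by rewrite -(perm_cons q) in perm_s; rewrite (permPl perm_s) -cat1s perm_catCA.
move=> p; rewrite in_cons => /orP[/eqP->|]; last exact: s2g.
by move=> qg; apply: nqf; rewrite def_f; exact: divides_mull.
Qed.

Lemma primitive_cancel (Rfact : factorial_ring R) f c g :
  primitive_poly f -> c != 0 -> divides f (c%:P * g) -> divides f g.
Proof.
move=> fP c0 [h def_g].
have [c1 [c2 [h' [f' [_ _ def_f def_g']]]]] := gauss Rfact c0 def_g.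
have Uc2 : c2 \is a GRing.unit by apply: fP; exists f'; rewrite def_f mulrC.
exists (h' * c2^-1%:P); rewrite def_g' def_f -!mulrA; congr (_ * _).
by rewrite mulrA -polyCM mulVr // mul1r.
Qed.

(** If [f] divides [g * h], take [M] of least degree in the ideal [(f, g)].
    It divides [f] and [g] up to constants, so by irreducibility it is
    associated with [f] up to constants, and then [f] divides [g], or it is
    itself a constant, and then [f] divides [M * h] and so [h]. *)
Lemma primitive_prime (Rfact : factorial_ring R) f :
  primitive_poly f -> (1 < size f)%N ->
  (forall g h, f = g * h -> (size g <= 1)%N \/ (size h <= 1)%N) ->
  prime_element f.
Proof.
move=> fP szf firr; have f0 : f != 0 by rewrite -size_poly_gt0 ltnW.
split=> //; first by rewrite poly_unitE gtn_eqF.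
move=> g h [w def_gh].
pose J M := exists a b, M = a * f + b * g.
have [|d [M [JM M0 def_d]] minM] :=
    @least_nat (fun e : nat => exists M, [/\ J M, M != 0 & size M = e]).
  by exists (size f), f; split=> //; exists 1, 0; rewrite mul1r mul0r addr0.
have [a [b def_M]] := JM.
have M_divides t : J t -> exists2 c, c != 0 & divides M (c%:P * t).
  move=> [a' [b' def_t]]; exists (lead_coef M ^+ scalp t M).
    by rewrite expf_neq0 // lead_coef_eq0.
  have := Pdiv.Idomain.divp_eq t M; rewrite -mul_polyC => def_r.
  suff r0 : t %% M = 0 by exists (t %/ M); rewrite def_r r0 addr0.
  apply/eqP/negPn/negP => r0; have := ltn_modpN0 t M0; apply/negP; rewrite -leqNgt.
  rewrite def_d; apply: minM; exists (t %% M); split=> //.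
  pose l := (lead_coef M ^+ scalp t M)%:P.
  exists (l * a' - (t %/ M) * a), (l * b' - (t %/ M) * b).
  have -> : t %% M = l * t - (t %/ M) * M by rewrite def_r addrC addKr.
  by rewrite def_t def_M; ring.
have [|c c0 [s def_f]] := M_divides f; first by exists 1, 0; rewrite mul1r mul0r addr0.
have [c1 [c2 [s' [M' [def_c def_s def_M' def_f']]]]] := gauss Rfact c0 def_f.
case: (firr _ _ def_f') => [sz_s|sz_M].
  left; have [|c' c'0 [t def_g]] := M_divides g.
    by exists 0, 1; rewrite mul1r mul0r add0r.
  have def_s' := size1_polyC sz_s; set e := s'`_0 in def_s'.
  have e0 : e != 0.
    by apply: contra_neq f0 => e0; rewrite def_f' def_s' e0 mul0r.
  apply: (@primitive_cancel Rfact f (e * c') g fP); first by rewrite mulf_neq0.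
  exists (t * c2%:P).
  rewrite polyCM -mulrA def_g def_f' def_s' def_M'; ring.
right; have def_MC : M = (M`_0)%:P.
  apply: size1_polyC; rewrite def_M'; apply: leq_trans (size_polyMleq _ _) _.
  by rewrite size_polyC; case: (c2 != 0); move: sz_M => /=; lia.
apply: (@primitive_cancel Rfact f M`_0 h fP).
  by apply: contra_neq M0 => e0; rewrite def_MC e0.
exists (a * h + b * w); rewrite -def_MC def_M mulrDl -[b * g * h]mulrA def_gh.
ring.
Qed.

(** By induction on the degree: once its constant primes are stripped, a
    polynomial either splits into two of smaller degree or is prime. *)
Lemma factorial_ring_poly (Rfact : factorial_ring R) :
  factorial_ring ({poly R} : idomainType).
Proof.
move=> f; have [b szf] := ubnP (size f); elim: b f szf => // b IHb f szf f0.
have [s [g [sP gP def_f]]] := primitive_part Rfact f0.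
suff [u [t [Uu tP def_g]]] : exists (u : {poly R}) t, [/\ u \is a GRing.unit,
    forall p, p \in t -> prime_element p & g = u * \prod_(p <- t) p].
  exists u, ([seq p%:P | p <- s] ++ t); split=> //.
    move=> p; rewrite mem_cat => /orP[/mapP[q qs ->]|]; last exact: tP.
    exact/prime_elementC/sP.
  by rewrite def_f def_g big_cat big_map -rmorph_prod /=; ring.
have g0 : g != 0 by apply: contra_neq f0 => g0; rewrite def_f g0 mulr0.
have s0 : \prod_(p <- s) p != 0.
  by apply: contra_neq f0 => s0; rewrite def_f s0 mul0r.
have szg : (size g < b.+1)%N.
  by move: szf; rewrite def_f size_Cmul.
have [sz1|szg1] := leqP (size g) 1.
  have def_g := size1_polyC sz1; exists g, [::]; split=> //; last first.
    by rewrite big_nil mulr1.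
  rewrite poly_unitE; have -> : size g = 1%N by apply/eqP; rewrite eqn_leq sz1 size_poly_gt0.
  by rewrite eqxx /=; apply: gP; rewrite -def_g; exact: divides_refl.
case: (classic (forall g1 g2, g = g1 * g2 -> (size g1 <= 1)%N \/ (size g2 <= 1)%N)).
  move=> girr; exists 1, [:: g]; rewrite unitr1 big_seq1 mul1r; split=> // p.
  by rewrite inE => /eqP->; exact: primitive_prime.
move=> red; have [g1 red1] := not_all_ex_not _ _ red.
have [g2 red2] := not_all_ex_not _ _ red1.
have [def_g large] := imply_to_and _ _ red2.
have [/negP sz1 /negP sz2] := not_or_and _ _ large.
have g1_0 : g1 != 0 by apply: contra_neq g0 => e; rewrite def_g e mul0r.
have g2_0 : g2 != 0 by apply: contra_neq g0 => e; rewrite def_g e mulr0.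
have szM := size_mul g1_0 g2_0; rewrite -def_g in szM.
have lt1 : (size g1 < b)%N by lia.
have lt2 : (size g2 < b)%N by lia.
have [u1 [t1 [Uu1 t1P def_g1]]] := IHb g1 lt1 g1_0.
have [u2 [t2 [Uu2 t2P def_g2]]] := IHb g2 lt2 g2_0.
exists (u1 * u2), (t1 ++ t2); rewrite unitrM Uu1 Uu2 big_cat def_g def_g1 def_g2.
split=> //; last by rewrite /=; ring.
by move=> p; rewrite mem_cat => /orP[/t1P|/t2P].
Qed.

End Factorial.

(** * Multivariate polynomials as polynomials in the last variable *)

Section MpolyInduction.
Variables (R : comNzRingType) (n : nat).

Lemma mpoly_gen_ind (Q : {mpoly R[n]} -> Prop) :
  (forall c, Q c%:MP) -> (forall i, Q 'X_i) ->
  (forall p q, Q p -> Q q -> Q (p + q)) ->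
  (forall p q, Q p -> Q q -> Q (p * q)) -> forall p, Q p.
Proof.
move=> QC QX QD QM p.
have QXm m : Q 'X_[m].
  rewrite mpolyXE_id; elim/big_rec: _ => [|i q _ Qq]; first by rewrite -mpolyC1.
  apply: (QM _ _ _ Qq); elim: (m i) => [|e IHe]; first by rewrite expr0 -mpolyC1.
  by rewrite exprS; exact: QM.
elim/mpolyind: p => [|c m p _ _ Qp]; first by rewrite -mpolyC0.
by apply: QD Qp; rewrite -mul_mpolyC; exact: QM.
Qed.

End MpolyInduction.

Section LastVariable.
Variables (K : fieldType) (n : nat).
Local Notation P := {mpoly K[n.+1]}.
Local Notation R := {mpoly K[n]}.
Implicit Types (p q : P) (u v : {poly R}).

Local Notation wid := (widen_ord (leqnSn n)).

Lemma muniXm (m : 'X_{1..n.+1}) :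
  muni ('X_[m] : P) = 'X_[[multinom m (wid i) | i < n]] *: 'X^(m ord_max).
Proof. by rewrite muniE msuppX big_seq1 mcoeffX eqxx scale1r. Qed.

Lemma muniX_widen (i : 'I_n) : muni ('X_(wid i) : P) = ('X_i)%:P.
Proof.
rewrite muniXm mnm1E -val_eqE /= ltn_eqF // expr0 alg_polyC; congr ('X_[_])%:P.
by apply/mnmP => j; rewrite mnmE !mnm1E -!val_eqE.
Qed.

Lemma muniX_max : muni ('X_ord_max : P) = 'X.
Proof.
rewrite muniXm mnm1E eqxx expr1 (_ : [multinom _ | _ < n] = 0%MM) ?mpolyX0 ?scale1r //.
by apply/mnmP => j; rewrite mnmE mnm1E mnm0E -val_eqE /= gtn_eqF.
Qed.

(** The inverse of [muni]. *)
Definition unimulti u : P := (map_poly (@mwiden n K) u).['X_ord_max].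

Lemma unimultiD : {morph unimulti : u v / u + v}.
Proof. by move=> u v; rewrite /unimulti rmorphD hornerD. Qed.

Lemma unimultiM : {morph unimulti : u v / u * v}.
Proof. by move=> u v; rewrite /unimulti rmorphM hornerM. Qed.

Lemma unimultiC (a : R) : unimulti a%:P = mwiden a.
Proof. by rewrite /unimulti map_polyC hornerC. Qed.

Lemma unimultiX : unimulti 'X = 'X_ord_max.
Proof. by rewrite /unimulti map_polyX hornerX. Qed.

Lemma muni_mwiden (a : R) : muni (mwiden a) = a%:P.
Proof.
elim/mpoly_gen_ind: a => [c|i|a b IHa IHb|a b IHa IHb].
- by rewrite mwidenC muniC.
- by rewrite mwidenX mnmwiden1 muniX_widen.
- by rewrite mwidenD muniD IHa IHb polyCD.
- by rewrite mwidenM muniM IHa IHb polyCM.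
Qed.

Lemma ord_max_or_widen (i : 'I_n.+1) : i = ord_max \/ exists j, i = wid j.
Proof.
case: (ltnP i n) => [lt_in|le_ni].
  by right; exists (Ordinal lt_in); apply: val_inj.
by left; apply: val_inj; apply/eqP; rewrite eqn_leq le_ni -ltnS ltn_ord.
Qed.

Opaque unimulti.

Lemma muniK : cancel (@muni n K) unimulti.
Proof.
elim/mpoly_gen_ind => [c|i|p q IHp IHq|p q IHp IHq].
- by rewrite muniC unimultiC mwidenC.
- have [->|[j ->]] := ord_max_or_widen i; first by rewrite muniX_max unimultiX.
  by rewrite muniX_widen unimultiC mwidenX mnmwiden1.
- by rewrite muniD unimultiD; congr (_ + _).
- by rewrite muniM unimultiM; congr (_ * _).
Qed.

Lemma unimultiK : cancel unimulti (@muni n K).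
Proof.
elim/poly_ind => [|u c IHu].
  by rewrite unimultiC (raddf0 (@mwiden n K)) muni0.
by rewrite unimultiD unimultiM unimultiX unimultiC muniD muniM muniX_max IHu muni_mwiden.
Qed.

Lemma muni_eq0 p : (muni p == 0) = (p == 0).
Proof. by rewrite -(inj_eq (can_inj muniK)) muni0. Qed.

Lemma divides_muni p q : divides (muni p) (muni q) <-> divides p q.
Proof.
split=> -[u def_q]; last by exists (muni u); rewrite def_q muniM.
by exists (unimulti u); rewrite -[LHS]muniK def_q unimultiM muniK.
Qed.

Lemma mnm_rconsE (m : 'X_{1..n}) i (j : 'I_n.+1) :
  [multinom of rcons m i] j = nth i m j.
Proof.
rewrite (mnm_nth i) /= nth_rcons size_tuple.
have [->|[k ->]] := ord_max_or_widen j; last by rewrite /= ltn_ord.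
by rewrite /= ltnn eqxx nth_default ?size_tuple.
Qed.

Lemma mnm_rconsK (m : 'X_{1..n.+1}) (m' : 'X_{1..n}) i :
  (m == [multinom of rcons m' i]) =
  ([multinom m (wid j) | j < n] == m') && (m ord_max == i).
Proof.
apply/eqP/andP => [->|[/eqP<- /eqP<-]].
  split; last by rewrite mnm_rconsE nth_default ?size_tuple.
  by apply/eqP/mnmP => j; rewrite mnmE mnm_rconsE [RHS](mnm_nth i).
apply/mnmP => j; rewrite mnm_rconsE.
have [->|[k ->]] := ord_max_or_widen j; first by rewrite nth_default ?size_tuple.
by rewrite -[LHS](mnmE (fun k => m (wid k))) (mnm_nth (m ord_max)).
Qed.

Lemma coef_muni p (i : nat) (m : 'X_{1..n}) :
  (muni p)`_i@_m = p@_[multinom of rcons m i].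
Proof.
rewrite muniE [in RHS](mpolyE p) coef_sum !linear_sum; apply: eq_bigr => /= m' _.
rewrite !coefZ coefXn mulr_natr mcoeffMn !mcoeffZ !mcoeffX.
by rewrite -mulrnAr -mulrnA mulnb mnm_rconsK [i == _]eq_sym.
Qed.

Lemma size_muni_leP p (b : nat) :
  reflect {in msupp p, forall m : 'X_{1..n.+1}, m ord_max < b}%N (size (muni p) <= b)%N.
Proof.
apply: (iffP idP) => [le_sz m|pb].
  apply: contraTT; rewrite -leqNgt => le_bm; rewrite mcoeff_msupp negbK.
  have /eqP-> : m == [multinom of rcons [multinom m (wid i) | i < n] (m ord_max)].
    by rewrite mnm_rconsK !eqxx.
  by rewrite -coef_muni nth_default ?mcoeff0 // (leq_trans le_sz).
apply/leq_sizeP => i le_bi; apply/mpolyP => m; rewrite coef_muni mcoeff0.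
apply/eqP; rewrite -[_ == 0]negbK -mcoeff_msupp; apply/negP => /pb.
by rewrite mnm_rconsE nth_default ?size_tuple //= ltnNge le_bi.
Qed.

Lemma size_muni_msize p : (size (muni p) <= msize p)%N.
Proof.
apply/size_muni_leP => m /msize_mdeg_lt; apply: leq_ltn_trans.
by rewrite mdegE (bigD1 ord_max) //= leq_addr.
Qed.

End LastVariable.

Lemma factorial_ring_mpoly (K : fieldType) (n : nat) : factorial_ring {mpoly K[n]}.
Proof.
elim: n => [|n IHn] a a0.
  exists a, [::]; split=> //; last by rewrite big_nil mulr1.
  have def_a : a = (a@_0)%:MP.
    by apply/mpolyP => m; rewrite mcoeffC (_ : m = 0%MM) ?eqxx ?mulr1 //;
      apply/mnmP => -[].
  apply/unitrPr; exists (a@_0)^-1%:MP; rewrite {1}def_a -mpolyCM divff //.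
  by apply: contra_neq a0 => e; rewrite def_a e.
have [u [s [/unitrPr[v uv] sP def_a]]] : exists u s, [/\ u \is a GRing.unit,
    forall p, p \in s -> prime_element p & muni a = u * \prod_(p <- s) p].
  by apply: (factorial_ring_poly IHn); rewrite muni_eq0.
exists (unimulti u), (map (@unimulti K n) s); split=> [|p|].
- apply/unitrPr; exists (unimulti v); rewrite -unimultiM uv.
  by rewrite -[RHS]muniK muni1.
- move=> /mapP[q /sP[q0 qU qP] ->]; split.
  + by rewrite -muni_eq0 unimultiK.
  + apply: contra qU => /unitrPr[v' qv]; apply/unitrPr; exists (muni v').
    by rewrite -[q in LHS]unimultiK -muniM qv muni1.
  + move=> b c /divides_muni; rewrite unimultiK muniM => /qP[] qb; [left|right].
      by apply/divides_muni; rewrite unimultiK.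
    by apply/divides_muni; rewrite unimultiK.
- rewrite -[LHS]muniK def_a unimultiM big_map; congr (_ * _).
  elim: {+}s => [|q t IHt]; last by rewrite !big_cons unimultiM IHt.
  by rewrite !big_nil -[RHS]muniK muni1.
Qed.

(** * Ideals and homogeneous components *)

Section IdealTheory.
Variable R : comNzRingType.
Implicit Types (S I J : R -> Prop).

Section OneIdeal.
Variable I : R -> Prop.
Hypothesis idI : is_ideal I.

Lemma ideal_zero : I 0. Proof. by case: idI. Qed.

Lemma ideal_addr p q : I p -> I q -> I (p + q).
Proof. by case: idI => _ + _; apply. Qed.

Lemma ideal_mull p q : I q -> I (p * q).
Proof. by case: idI => _ _; apply. Qed.

Lemma ideal_mulr p q : I p -> I (p * q).
Proof. by rewrite mulrC; exact: ideal_mull. Qed.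

Lemma ideal_oppr p : I p -> I (- p).
Proof. by rewrite -mulN1r; exact: ideal_mull. Qed.

Lemma ideal_subr p q : I p -> I q -> I (p - q).
Proof. by move=> Ip /ideal_oppr; exact: ideal_addr. Qed.

Lemma ideal_sum (T : Type) (r : seq T) (Q : pred T) (F : T -> R) :
  (forall i, Q i -> I (F i)) -> I (\sum_(i <- r | Q i) F i).
Proof. by move=> IF; apply: big_ind => //; [exact: ideal_zero | exact: ideal_addr]. Qed.

End OneIdeal.

Lemma ideal_gen_ideal S : is_ideal (ideal_gen S).
Proof.
split=> [|p q [s sS ->] [t tS ->]|p q [s sS ->]].
- by exists [::]; rewrite ?big_nil.
- exists (s ++ t); rewrite ?big_cat // => u; rewrite mem_cat.
  by case/orP; [exact: sS | exact: tS].
- exists [seq (p * u.1, u.2) | u <- s] => [u /mapP[v vs ->]|]; first exact: (sS v).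
  by rewrite big_map mulr_sumr; apply: eq_bigr => u _; rewrite mulrA.
Qed.

Lemma ideal_gen_incl S p : S p -> ideal_gen S p.
Proof.
move=> Sp; exists [:: (1, p)] => [u|]; first by rewrite inE => /eqP->.
by rewrite big_seq1 mul1r.
Qed.

Lemma ideal_gen_sub S J : is_ideal J -> (forall p, S p -> J p) ->
  forall p, ideal_gen S p -> J p.
Proof.
move=> idJ SJ p [s sS ->]; rewrite big_seq; apply: ideal_sum => // u us.
by apply: ideal_mull => //; apply/SJ/sS.
Qed.

End IdealTheory.

Section Homogeneous.
Variables (K : fieldType) (n : nat).
Local Notation P := {mpoly K[n]}.
Implicit Types (I : P -> Prop) (p q : P).

Lemma mcoeff_pihomog d p m : (pihomog mdeg d p)@_m = p@_m *+ (mdeg m == d).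
Proof.
elim/mpolyind: p => [|c m' p _ _ IHp]; first by rewrite linear0 !mcoeff0 mul0rn.
rewrite linearP /= !mcoeffD IHp mulrnDl pihomogX mcoeffZ; congr (_ + _).
rewrite !mcoeffZ -mulrnAr; congr (_ * _).
case: eqP => [<-|dm']; rewrite ?mcoeff0 ?mcoeffX;
  case: (eqVneq m' m) => [<-|]; rewrite ?eqxx ?mul0rn //.
by move/eqP/negbTE: dm' => ->.
Qed.

Lemma pihomogM d e p q : q \is e.-homog ->
  pihomog mdeg (d + e) (p * q) = pihomog mdeg d p * q.
Proof.
move=> hq; elim/mpolyind: p => [|c m p _ _ IHp]; first by rewrite !(mul0r, linear0).
rewrite mulrDl !linearD /= IHp mulrDl; congr (_ + _).
rewrite -scalerAl !linearZ /= -scalerAl; congr (_ *: _); rewrite pihomogX.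
have hXq : 'X_[m] * q \is (mdeg m + e).-homog by rewrite dhomogM ?dhomogX.
case: eqP => [<-|/eqP ne_md]; first by rewrite pihomog_dE.
by rewrite mul0r (pihomog_ne0 _ hXq) // eqn_add2r.
Qed.

Lemma pihomogM_lt d e p q : q \is e.-homog -> (d < e)%N ->
  pihomog mdeg d (p * q) = 0.
Proof.
move=> hq lt_de; elim/mpolyind: p => [|c m p _ _ IHp].
  by rewrite !(mul0r, linear0).
rewrite mulrDl !linearD /= IHp addr0 -scalerAl linearZ /=.
have hXq : 'X_[m] * q \is (mdeg m + e).-homog by rewrite dhomogM ?dhomogX.
by rewrite (pihomog_ne0 _ hXq) ?scaler0 // gtn_eqF // ltn_addl.
Qed.

Lemma mpolyX_neq0 m : 'X_[m] != 0 :> P.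
Proof. by rewrite -msupp_eq0 msuppX. Qed.

Lemma homog_X (i : 'I_n) : ('X_i : P) \is 1.-homog.
Proof. by rewrite dhomogX /= mdeg1. Qed.

Lemma homog_XM (i : 'I_n) d p : p \is d.-homog -> 'X_i * p \is d.+1.-homog.
Proof. by move=> hp; rewrite -add1n dhomogM ?homog_X. Qed.

Lemma homog_XnM (i : 'I_n) e d p : p \is d.-homog -> 'X_i ^+ e * p \is (e + d).-homog.
Proof. by move=> hp; rewrite dhomogM //; have := dhomogMn e (homog_X i); rewrite mul1n. Qed.

Lemma pihomog_sum p : p = \sum_(d < msize p) pihomog mdeg d p.
Proof. exact: pihomog_partitionE. Qed.

(** The space [X_0 N_d + ... + X_{r-1} N_d]. *)
Definition var_span (N : P -> Prop) (r d : nat) (w : P) : Prop :=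
  exists2 v : 'I_n -> P, (forall s, N (v s) /\ v s \is d.-homog)
                       & w = \sum_(s < n | (s < r)%N) 'X_s * v s.

Lemma var_span_add N r d w1 w2 : is_ideal N ->
  var_span N r d w1 -> var_span N r d w2 -> var_span N r d (w1 + w2).
Proof.
move=> idN [v1 v1N ->] [v2 v2N ->]; exists (fun s => v1 s + v2 s).
  move=> s; have [Nv1 hv1] := v1N s; have [Nv2 hv2] := v2N s.
  by split; [exact: ideal_addr | exact: rpredD].
by rewrite -big_split; apply: eq_bigr => s _; rewrite mulrDr.
Qed.

Lemma var_span0 N r d : is_ideal N -> var_span N r d 0.
Proof.
move=> idN; exists (fun _ => 0) => [s|]; first by split; [exact: ideal_zero | exact: rpred0].
by rewrite big1 // => s _; rewrite mulr0.
Qed.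

Lemma var_spanX N r d (s : 'I_n) w : is_ideal N -> (s < r)%N ->
  N w -> w \is d.-homog -> var_span N r d ('X_s * w).
Proof.
move=> idN lt_sr Nw hw; exists (fun t => w *+ (t == s)) => [t|].
  by case: eqP => _; split=> //; [exact: ideal_zero | exact: rpred0].
rewrite (bigD1 s) //= eqxx mulr1n big1 ?addr0 // => t /andP[_ /negbTE->].
by rewrite mulr0n mulr0.
Qed.

Section Truncation.
Variables (I : P -> Prop) (b : nat).
Hypothesis homI : homogeneous_ideal I.
Let idI : is_ideal I := proj1 homI.
Local Notation N := (truncation_ideal I b).

Lemma truncation_is_ideal : is_ideal N.
Proof. exact: ideal_gen_ideal. Qed.

Lemma truncation_sub p : N p -> I p.
Proof. by apply: ideal_gen_sub => // q []. Qed.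

Lemma truncation_incl d p : (d <= b)%N -> I p -> p \is d.-homog -> N p.
Proof. by move=> le_db Ip hp; apply: ideal_gen_incl; split=> //; exists d. Qed.

Lemma truncation_homogeneous : homogeneous_ideal N.
Proof.
split=> [|p d [s sS ->]]; first exact: truncation_is_ideal.
rewrite linear_sum /= big_seq; apply: ideal_sum => [|u /sS[Iu [e le_eb hu]]].
  exact: truncation_is_ideal.
have Nu := truncation_incl le_eb Iu hu.
have [lt_de|/subnK<-] := ltnP d e.
  by rewrite (pihomogM_lt _ hu lt_de); apply: ideal_zero truncation_is_ideal.
by rewrite pihomogM //; apply: ideal_mull truncation_is_ideal _ _ Nu.
Qed.

(** Above the degrees of its generators the ideal grows only by
    multiplication with variables. *)
Lemma truncation_var_span d p : (b <= d)%N -> N p -> p \is d.+1.-homog ->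
  var_span N n d p.
Proof.
move=> le_bd [s sS def_p] hp; rewrite -(pihomog_dE hp) def_p linear_sum /= big_seq.
apply: big_ind => [||u /sS[Iu [e le_eb hu]]].
- exact: var_span0 truncation_is_ideal.
- by move=> x y; apply: var_span_add truncation_is_ideal.
have Nu := truncation_incl le_eb Iu hu; have idN := truncation_is_ideal.
elim/mpolyind: u.1 => [|c m q _ _ IHq].
  by rewrite mul0r linear0; exact: var_span0.
rewrite mulrDl linearD /=; apply: var_span_add IHq => //.
have h_cXu : c *: 'X_[m] * u.2 \is (mdeg m + e).-homog.
  by rewrite dhomogM // rpredZ // dhomogX.
have [def_d|ne_d] := eqVneq (mdeg m + e)%N d.+1; last first.
  by rewrite (pihomog_ne0 ne_d h_cXu); exact: var_span0.
rewrite pihomog_dE -?def_d //.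
have : m != 0%MM by rewrite -mdeg_eq0; lia.
rewrite -mdeg_eq0 mdegE sum_nat_eq0 negb_forall => /existsP[t /= mt0].
have def_m : m = (U_(t) + (m - U_(t)))%MM by rewrite addmC submK // lep1mP.
rewrite def_m mpolyXD scalerAr -mulrA; apply: var_spanX => //.
  exact: ideal_mull.
rewrite (_ : d = (mdeg (m - U_(t)) + e)%N); first by rewrite dhomogM // rpredZ // dhomogX.
by move: def_d; rewrite {1}def_m mdegD mdeg1; lia.
Qed.

End Truncation.

Lemma homogeneous_truncationP I : homogeneous_ideal I -> forall p,
  I p <-> forall d, I (pihomog mdeg d p).
Proof.
move=> [idI homI] p; split=> [Ip d|Ip]; first exact: homI.
by rewrite (pihomog_sum p); apply: ideal_sum.
Qed.

Lemma irrelevant_colonP I p : is_ideal I ->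
  ideal_colon I (@irrelevant_ideal K n) p <-> forall i : 'I_n, I (p * 'X_i).
Proof.
move=> idI; split=> [Ip i|Ip q].
  by apply: Ip; apply: ideal_gen_incl; exists i.
apply: (@ideal_gen_sub _ _ (fun q => I (p * q))) => [|_ [i ->]]; last exact: Ip.
split=> [|q1 q2|q1 q2]; rewrite ?mulr0 ?mulrDr; first exact: ideal_zero.
  exact: ideal_addr.
by rewrite mulrCA; exact: ideal_mull.
Qed.

Lemma saturatedP I : is_ideal I ->
  saturated I <-> forall p, (forall i : 'I_n, I (p * 'X_i)) -> I p.
Proof.
move=> idI; split=> [satI p /(irrelevant_colonP _ idI) /satI //|satI p].
split=> [/(irrelevant_colonP _ idI) /satI //|Ip q _].
exact: ideal_mulr.
Qed.

End Homogeneous.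

(** * Regularity modulo the first variables *)

(** The residue modulo [(X_0, ..., X_{r-1})], represented in the polynomial ring
    itself so that no quotient ring has to be formed. *)
HB.lock Definition kill (K : fieldType) n (r : nat) (p : {mpoly K[n]}) :=
  p \mPo [tuple if (i < r)%N then 0 else 'X_i | i < n].

Section Kill.
Variables (K : fieldType) (n : nat).
Local Notation P := {mpoly K[n]}.
Implicit Types (N : P -> Prop) (p q w : P) (r d : nat).

Lemma killC r c : kill r c%:MP = c%:MP :> P.
Proof. by rewrite kill.unlock comp_mpolyC. Qed.

Lemma killX r (i : 'I_n) : kill r 'X_i = if (i < r)%N then 0 else 'X_i :> P.
Proof. by rewrite kill.unlock comp_mpolyXU -tnth_nth tnth_mktuple. Qed.

Lemma kill1 r : kill r 1 = 1 :> P.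
Proof. by rewrite -mpolyC1 killC. Qed.

Lemma kill0 r : kill r 0 = 0 :> P.
Proof. by rewrite kill.unlock comp_mpoly0. Qed.

Lemma killD r p q : kill r (p + q) = kill r p + kill r q.
Proof. by rewrite kill.unlock comp_mpolyD. Qed.

Lemma killB r p q : kill r (p - q) = kill r p - kill r q.
Proof. by rewrite kill.unlock comp_mpolyB. Qed.

Lemma killM r : {morph @kill K n r : p q / p * q}.
Proof. by move=> p q; rewrite kill.unlock rmorphM. Qed.

Lemma killZ r c p : kill r (c *: p) = c *: kill r p.
Proof. by rewrite kill.unlock comp_mpolyZ. Qed.

Lemma killXn r p e : kill r (p ^+ e) = kill r p ^+ e.
Proof. by rewrite kill.unlock rmorphXn. Qed.

Lemma kill_sum r (T : Type) (s : seq T) (Q : pred T) (F : T -> P) :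
  kill r (\sum_(i <- s | Q i) F i) = \sum_(i <- s | Q i) kill r (F i).
Proof. by rewrite kill.unlock raddf_sum. Qed.

Lemma kill_Xm r m :
  kill r 'X_[m] = if [exists i : 'I_n, (i < r)%N && (m i != 0%N)] then 0 else 'X_[m] :> P.
Proof.
rewrite mpolyXE_id (big_morph _ (killM r) (kill1 r)) /=; case: ifPn => [/existsP[i /andP[lt_ir mi0]]|].
  by rewrite (bigD1 i) //= killXn killX lt_ir expr0n (negbTE mi0) mul0r.
rewrite negb_exists => /forallP m0; apply: eq_bigr => i _.
rewrite killXn killX; case: ifP => // lt_ir.
by have := m0 i; rewrite lt_ir negbK => /eqP->; rewrite !expr0.
Qed.

Lemma mcoeff_kill r p m :
  (kill r p)@_m = if [exists i : 'I_n, (i < r)%N && (m i != 0%N)] then 0 else p@_m.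
Proof.
elim/mpolyind: p => [|c m' p _ _ IHp]; first by rewrite kill0 !mcoeff0 if_same.
rewrite killD killZ !mcoeffD {}IHp !mcoeffZ kill_Xm mcoeffX.
case: (eqVneq m' m) => [->|ne_m'm]; first by case: ifP; rewrite ?mcoeff0 ?mulr0 ?addr0 ?mcoeffX ?eqxx.
by case: ifP; case: ifP; rewrite ?mcoeff0 ?mcoeffX ?(negbTE ne_m'm) !mulr0 add0r.
Qed.

Lemma kill_kill r s p : (r <= s)%N -> kill s (kill r p) = kill s p.
Proof.
move=> le_rs; apply/mpolyP => m; rewrite !mcoeff_kill.
case: ifPn => // /existsPn m0; case: ifPn => // /existsP[i /andP[lt_ir mi0]].
by have := m0 i; rewrite (leq_trans lt_ir) // mi0.
Qed.

Lemma kill_none p : kill 0 p = p.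
Proof. by apply/mpolyP => m; rewrite mcoeff_kill; case: existsP => // -[i]. Qed.

Lemma msupp_kill r p : {subset msupp (kill r p) <= msupp p}.
Proof. by move=> m; rewrite !mcoeff_msupp mcoeff_kill; case: ifP; rewrite ?eqxx. Qed.

Lemma homog_kill r d p : p \is d.-homog -> kill r p \is d.-homog.
Proof. by move/dhomogP => hp; apply/dhomogP => m /msupp_kill /hp. Qed.

Lemma pihomog_kill r d p : pihomog mdeg d (kill r p) = kill r (pihomog mdeg d p).
Proof.
apply/mpolyP => m; rewrite mcoeff_kill !mcoeff_pihomog mcoeff_kill.
by case: ifP; rewrite ?mul0rn.
Qed.

Lemma kill_all d p : p \is d.+1.-homog -> kill n p = 0.
Proof.
move=> /dhomogP hp; apply/mpolyP => m; rewrite mcoeff_kill mcoeff0.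
case: ifPn => // /existsPn m0; apply/eqP; rewrite -[_ == 0]negbK -mcoeff_msupp.
apply/negP => /hp; rewrite /= mdegE big1 // => i _.
by have := m0 i; rewrite ltn_ord negbK => /eqP.
Qed.

Lemma kill_step (t : 'I_n) p : exists u, kill t p = 'X_t * u + kill t.+1 p.
Proof.
elim/mpoly_gen_ind: p => [c|i|p q [u def_p] [v def_q]|p q [u def_p] [v def_q]].
- by exists 0; rewrite !killC mulr0 add0r.
- rewrite !killX [(i < t.+1)%N]ltnS [(i <= t)%N]leq_eqVlt; case: (eqVneq i t) => [->|].
    by exists 1; rewrite ltnn eqxx mulr1 addr0.
  by rewrite -val_eqE => /negbTE-> /=; exists 0; rewrite mulr0 add0r.
- by exists (u + v); rewrite !killD def_p def_q; ring.
- exists (u * kill t q + kill t.+1 p * v).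
  by rewrite !killM {1}def_p def_q; ring.
Qed.

Lemma kill_step_homog (t : 'I_n) d p : p \is d.+1.-homog -> kill t.+1 p = 0 ->
  exists2 u, u \is d.-homog & kill t p = 'X_t * kill t u.
Proof.
move=> hp p0; have [u def_p] := kill_step t p.
exists (pihomog mdeg d u); first exact: pihomogP.
rewrite p0 addr0 in def_p.
rewrite -(pihomog_dE (homog_kill t hp)).
rewrite -[kill t p](@kill_kill t t) // def_p killM killX ltnn.
by rewrite mulrC -[d.+1]addn1 (pihomogM _ _ (homog_X K t)) -pihomog_kill mulrC.
Qed.

(** Membership in [N + (X_0, ..., X_{r-1})]. *)
Definition in_mod N r p : Prop := exists2 b, N b & kill r b = kill r p.

(** [X_t] is a nonzerodivisor on [P / (N + (X_0, ..., X_{t-1}))] in degree [d]. *)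
Definition regular_at N d (t : 'I_n) : Prop :=
  forall g, g \is d.-homog -> in_mod N t ('X_t * g) -> in_mod N t g.

Lemma in_mod_incl N r p : N p -> in_mod N r p.
Proof. by exists p. Qed.

Lemma in_mod_leq N r s p : (r <= s)%N -> in_mod N r p -> in_mod N s p.
Proof.
by move=> le_rs [b Nb eq_bp]; exists b => //; rewrite -(kill_kill b le_rs) eq_bp kill_kill.
Qed.

Lemma in_mod_homog N r d p : homogeneous_ideal N -> p \is d.-homog ->
  in_mod N r p -> exists b, [/\ N b, b \is d.-homog & kill r b = kill r p].
Proof.
move=> [_ homN] hp [b Nb eq_bp]; exists (pihomog mdeg d b).
split; [exact: homN | exact: pihomogP |].
by rewrite -pihomog_kill eq_bp pihomog_kill pihomog_dE.
Qed.

(** The intersection of [N_{d+1}] with [(X_0, ..., X_{r-1})] is no larger than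
    [X_0 N_d + ... + X_{r-1} N_d].  For all [r] together this is equivalent to
    regularity of all the variables in degree [d], and it is the form in which
    regularity passes from one degree to the next. *)
Definition shallow N d r : Prop :=
  forall w, N w -> w \is d.+1.-homog -> kill r w = 0 -> var_span N r d w.

(** If [w] lies in [N] and in [(X_0, ..., X_r)], then modulo the lower variables
    it is [X_r u], and regularity replaces [u] by an element [b] of [N]; what
    remains of [w] after subtracting [X_r b] involves one variable less. *)
Lemma regular_shallow N d : homogeneous_ideal N ->
  (forall t : 'I_n, regular_at N d t) -> forall r, (r <= n)%N -> shallow N d r.
Proof.
move=> homN regN; have idN := proj1 homN; elim=> [|r IHr] lt_rn w Nw hw w0.
  by rewrite -[w]kill_none w0; exact: var_span0.
pose t := Ordinal lt_rn; have [u hu def_w] := kill_step_homog (t := t) hw w0.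
have in_u : in_mod N t u.
  by apply: regN => //; exists w => //; rewrite def_w killM killX ltnn.
have [b [Nb hb eq_bu]] := in_mod_homog homN hu in_u.
have [|||v vN def_v] := IHr (ltnW lt_rn) (w - 'X_t * b).
- by apply: ideal_subr => //; exact: ideal_mull.
- by rewrite rpredB // homog_XM.
- by rewrite killB killM -[X in kill X w]/(val t) def_w -eq_bu killX ltnn subrr.
rewrite -[w](subrK ('X_t * b)) def_v; apply: var_span_add => //.
  apply: (@big_ind _ (var_span N r.+1 d)) => [||s lt_sr].
  - exact: var_span0.
  - by move=> x y; exact: var_span_add.
  - by have [Nv hv] := vN s; apply: var_spanX => //; exact: ltnW.
exact: var_spanX.
Qed.

(** A witness for [X_t g] in [N] modulo the lower variables is killed by
    [kill t.+1], hence is a combination of [X_0, ..., X_t] over [N]; the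
    coefficient of [X_t] is congruent to [g]. *)
Lemma shallow_regular N d (t : 'I_n) : homogeneous_ideal N ->
  shallow N d t.+1 -> regular_at N d t.
Proof.
move=> homN shN g hg /(in_mod_homog homN (homog_XM t hg))[b [Nb hb eq_bg]].
have [|v vN def_b] := shN b Nb hb.
  by rewrite -(kill_kill b (leqnSn t)) eq_bg kill_kill // killM killX ltnSn mul0r.
exists (v t); first by case: (vN t).
have Xt0 : 'X_t != 0 :> P by exact: mpolyX_neq0.
apply: (mulfI Xt0); move: eq_bg; rewrite killM killX ltnn => <-.
rewrite def_b (bigD1 t) //= killD killM killX ltnn kill_sum big1 ?addr0 //.
move=> s /andP[le_st ne_st]; rewrite killM killX ifT ?mul0r //.
by rewrite ltn_neqAle -ltnS le_st andbT.
Qed.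

(** In a combination of variables with top index [t >= r] that lies in
    [(X_0, ..., X_{r-1})], the coefficient of [X_t] lies in
    [(X_0, ..., X_{t-1})], so it is a combination of lower variables and [X_t]
    can be traded for them. *)
Lemma shallow_succ N d : homogeneous_ideal N ->
  (forall r, (r <= n)%N -> shallow N d r) ->
  (forall w, N w -> w \is d.+2.-homog -> var_span N n d.+1 w) ->
  forall r, (r <= n)%N -> shallow N d.+1 r.
Proof.
move=> homN shN genN r le_rn w Nw hw w0; have idN := proj1 homN.
suff lower t w' : (t <= n)%N -> kill r w' = 0 ->
    var_span N t d.+1 w' -> var_span N r d.+1 w'.
  exact: lower (leqnn n) w0 (genN w Nw hw).
elim: t w' => [|t IHt] w' lt_tn w'0.
  move=> [v _ ->]; rewrite big_pred0 //; exact: var_span0.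
have [le_rt|lt_tr] := leqP r t; last first.
  move=> [v vN def_w']; exists (fun s => v s *+ (s <= t)%N) => [s|].
    case: (s <= t)%N; first exact: vN.
    by split; [exact: ideal_zero | exact: rpred0].
  rewrite def_w' [RHS](bigID (fun s : 'I_n => (s < t.+1)%N)) /= [X in _ + X]big1.
    rewrite addr0; apply: eq_big => s; last by move=> lt_st; rewrite -ltnS lt_st.
    by rewrite ltnS; lia.
  by move=> s /andP[_]; rewrite ltnS => /negbTE->; rewrite mulr0.
move=> [v vN def_w']; pose t' := Ordinal lt_tn.
have [Nvt hvt] := vN t'.
have Xt0 : 'X_t' != 0 :> P by exact: mpolyX_neq0.
have vt0 : kill t (v t') = 0.
  apply: (mulfI Xt0); rewrite mulr0; move: w'0.
  move/(congr1 (kill t)); rewrite kill_kill // kill0 def_w' (bigD1 t') //=.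
  rewrite killD killM -[X in kill X 'X_t']/(val t') killX ltnn.
  rewrite kill_sum big1 ?addr0 // => s /andP[le_st ne_st].
  rewrite killM killX ifT ?mul0r //.
  by rewrite ltn_neqAle -ltnS le_st andbT.
have [u uN def_vt] := shN t (ltnW lt_tn) (v t') Nvt hvt vt0.
apply: IHt => //; first exact: ltnW.
rewrite def_w' (bigD1 t') //= addrC; apply: var_span_add => //.
  exists v => //; apply: eq_bigl => s; by rewrite -val_eqE /=; lia.
rewrite def_vt mulr_sumr; apply: (@big_ind _ (var_span N t d.+1)) => [||s lt_st].
- exact: var_span0.
- by move=> x y; exact: var_span_add.
have [Nu hu] := uN s; rewrite mulrCA; apply: var_spanX => //.
  exact: ideal_mull.
exact: homog_XM.
Qed.

Lemma regular_iter N d (t : 'I_n) e g :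
  (forall d', (d <= d')%N -> regular_at N d' t) -> g \is d.-homog ->
  in_mod N t ('X_t ^+ e * g) -> in_mod N t g.
Proof.
move=> regN hg; elim: e => [|e IHe]; first by rewrite expr0 mul1r.
rewrite exprS -mulrA => /regN ing; apply: IHe; apply: (ing (e + d)%N).
  exact: leq_addl.
exact: homog_XnM.
Qed.

End Kill.

(** * Regularity propagates to all higher degrees *)

Section Persistence.
Variables (K : fieldType) (n : nat).
Local Notation P := {mpoly K[n.+1]}.
Variables (I : P -> Prop) (b : nat).
Hypothesis (homI : homogeneous_ideal I) (satI : saturated I).
Hypothesis regI : forall t : 'I_n.+1, regular_at I b t.

Let idI : is_ideal I := proj1 homI.
Local Notation N := (truncation_ideal I b).
Let homN : homogeneous_ideal N := truncation_homogeneous I b.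
Let idN : is_ideal N := proj1 homN.

(** Forms of positive degree lie in the ideal of all variables, so shallowness for
    all variables together says that [I_{b+1}] is generated by [I_b]. *)
Lemma truncation_next d p : (d <= b.+1)%N -> I p -> p \is d.-homog -> N p.
Proof.
rewrite leq_eqVlt ltnS => /orP[/eqP->|le_db] Ip hp; last exact: truncation_incl hp.
 have [v vI ->] := regular_shallow homI regI (leqnn n.+1) Ip hp (kill_all hp).
apply: ideal_sum => // s _; apply: ideal_mull => //; have [Iv hv] := vI s.
exact: truncation_incl hv.
Qed.

(** In degree [b] the ideals [N] and [I] agree; above it [N] is generated by
    multiplication with variables, which is what [shallow_succ] needs. *)
Lemma truncation_shallow d : (b <= d)%N -> forall r, (r <= n.+1)%N -> shallow N d r.
Proof.
move=> /subnK<-; elim: (d - b)%N => [|e IHe]; last first.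
  rewrite addSn; apply: shallow_succ => // w Nw hw.
  by apply: truncation_var_span => //; rewrite leqW // leq_addl.
move=> r le_rn w Nw hw w0.
have [v vI ->] := regular_shallow homI regI le_rn (truncation_sub homI Nw) hw w0.
exists v => // s; have [Iv hv] := vI s; split=> //; exact: truncation_incl hv.
Qed.

Lemma truncation_regular d : (b <= d)%N -> forall t : 'I_n.+1, regular_at N d t.
Proof. by move=> le_bd t; apply: shallow_regular => //; exact: truncation_shallow. Qed.

Lemma truncation_stable p : N p <-> truncation_ideal I b.+1 p.
Proof.
split; apply: ideal_gen_sub; try exact: ideal_gen_ideal; move=> q [Iq [d le_d hq]].
  by apply: (truncation_incl _ Iq hq); exact: leqW.
exact: truncation_next hq.
Qed.

(** From degree [b] on the first variable is a nonzerodivisor modulo [N]; below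
    degree [b] saturation is inherited from [I], with which [N] agrees there. *)
Lemma truncation_saturated : saturated N.
Proof.
apply/(saturatedP idN) => p Np; apply/(homogeneous_truncationP homN) => d.
have Npd (i : 'I_n.+1) : N (pihomog mdeg d p * 'X_i).
  by rewrite -(pihomogM d p (homog_X K i)); exact: (proj2 homN).
have hpd := pihomogP mdeg d p.
have [le_bd|lt_db] := leqP b d.
  have [|q Nq] := truncation_regular le_bd (t := ord0) hpd.
    by apply: in_mod_incl; rewrite mulrC.
  by rewrite !kill_none => <-.
apply: (truncation_incl (ltnW lt_db) _ hpd).
by apply: (proj1 (saturatedP idI) satI) => i; exact: truncation_sub (Npd i).
Qed.

End Persistence.

(** * Quotient dimensions *)

Section QuotientDim.
Variables (K : fieldType) (n : nat).
Local Notation P := {mpoly K[n.+1]}.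
Local Notation V d := (dhomog n.+1 K d).
Implicit Types (J : P -> Prop).

Lemma quotient_dim_vspace J d e : quotient_dim J d e ->
  exists2 U : {vspace V d}, forall p : V d, p \in U <-> J p
                          & (\dim U + e)%N = \dim {:V d}.
Proof.
move=> [f f_surj f_ker]; exists (lker (linfun f)) => [p|].
  by rewrite memv_ker lfunE /= -f_ker; split=> /eqP.
rewrite -(limg_ker_dim (linfun f) fullv) capfv; congr (_ + _)%N.
have -> : limg (linfun f) = fullv; last by rewrite dimvf dim_matrix mul1r.
apply/vspaceP => v; rewrite memvf.
by have [p <-] := f_surj v; rewrite -[f p]lfunE memv_img ?memvf.
Qed.

Lemma quotient_dim_unique J d e1 e2 :
  quotient_dim J d e1 -> quotient_dim J d e2 -> e1 = e2.
Proof.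
move=> /quotient_dim_vspace[U UP dimU] /quotient_dim_vspace[W WP dimW].
have eqUW : U = W by apply/vspaceP => p; apply/idP/idP => [/UP/WP | /WP/UP].
by apply/eqP; rewrite -(eqn_add2l (\dim U)) dimU eqUW dimW.
Qed.

Lemma quotient_dim_eq J1 J2 d e :
  (forall p, p \is d.-homog -> J1 p <-> J2 p) ->
  quotient_dim J1 d e -> quotient_dim J2 d e.
Proof.
move=> eqJ [f f_surj f_ker]; exists f => // p; rewrite f_ker.
by apply: eqJ; exact: dhomog_is_dhomog.
Qed.

End QuotientDim.

(** * The greatest common divisor *)

(** Division by [u] is Euclidean, and [c] times the remainder is a multiple of
    [u] of smaller degree. *)
Lemma unit_lead_divides (R : idomainType) (u v : {poly R}) (c : R) :
  lead_coef u \is a GRing.unit -> c != 0 -> divides u (c%:P * v) -> divides u v.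
Proof.
move=> Uu c0 [w def_cv]; exists (v %/ u).
have u0 : u != 0 by rewrite -lead_coef_eq0; apply: contraTneq Uu => ->; rewrite unitr0.
have def_v := Pdiv.IdomainUnit.divp_eq Uu v.
suff r0 : v %% u = 0 by rewrite {1}def_v r0 addr0.
have def_r : c%:P * (v %% u) = (w - c%:P * (v %/ u)) * u.
  rewrite mulrBl -def_cv {2}def_v; ring.
apply/eqP/negPn/negP => r0.
have := ltn_modpN0 v u0; rewrite -(size_Cmul (v %% u) c0) def_r.
rewrite size_mul //; last first.
  by apply: contra_neq r0 => e0; move/eqP: def_r; rewrite e0 mul0r mulf_eq0 polyC_eq0 (negbTE c0) => /eqP.
rewrite ltnNge -ltnS prednK ?addn_gt0 ?size_poly_gt0 ?u0 ?orbT //.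
rewrite -[X in (X <= _)%N]add1n leq_add2r size_poly_gt0.
case: eqP => // e0; move/eqP: def_r; rewrite e0 mul0r mulf_eq0 polyC_eq0.
by rewrite (negbTE c0) (negbTE r0).
Qed.

(** Setting all variables but the last two to 0, then the first of these two
    to 1. *)
HB.lock Definition dehom (K : fieldType) (m : nat) (p : {mpoly K[m.+2]}) : {poly K} :=
  map_poly (meval (fun i : 'I_m.+1 => (i == ord_max)%:R)) (muni p).

Section Dehom.
Variables (K : fieldType) (m : nat).
Local Notation P := {mpoly K[m.+2]}.
Implicit Types (p q : P).
Local Notation ix := (widen_ord (leqnSn m.+1) ord_max : 'I_m.+2).
Local Notation iy := (ord_max : 'I_m.+2).

Lemma dehomD : {morph @dehom K m : p q / p + q}.
Proof. by move=> p q; rewrite dehom.unlock muniD rmorphD. Qed.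

Lemma dehomB : {morph @dehom K m : p q / p - q}.
Proof. by move=> p q; rewrite dehom.unlock muniB rmorphB. Qed.

Lemma dehomM : {morph @dehom K m : p q / p * q}.
Proof. by move=> p q; rewrite dehom.unlock muniM rmorphM. Qed.

Lemma dehomC c : dehom (c%:MP : P) = c%:P.
Proof. by rewrite dehom.unlock muniC map_polyC /= mevalC. Qed.

Lemma dehom0 : dehom (0 : P) = 0.
Proof. by rewrite -mpolyC0 dehomC. Qed.

Lemma dehomZ c p : dehom (c *: p) = c *: dehom p.
Proof. by rewrite -mul_mpolyC dehomM dehomC mul_polyC. Qed.

Lemma dehom_sum (T : Type) (s : seq T) (Q : pred T) (F : T -> P) :
  dehom (\sum_(i <- s | Q i) F i) = \sum_(i <- s | Q i) dehom (F i).
Proof. exact: (big_morph _ dehomD dehom0). Qed.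

Lemma dehomX e p : dehom (p ^+ e) = dehom p ^+ e.
Proof. by elim: e => [|e IHe]; rewrite ?expr0 -?mpolyC1 ?dehomC // !exprS dehomM IHe. Qed.

Lemma dehom_low (i : 'I_m.+2) : (i < m)%N -> dehom ('X_i : P) = 0.
Proof.
move=> lt_im; have lt_im1 : (i < m.+1)%N by exact: ltnW.
have -> : i = widen_ord (leqnSn m.+1) (Ordinal lt_im1) by exact: val_inj.
by rewrite dehom.unlock muniX_widen map_polyC /= mevalXU -val_eqE /= ltn_eqF.
Qed.

Lemma dehom_x : dehom ('X_ix : P) = 1.
Proof. by rewrite dehom.unlock muniX_widen map_polyC /= mevalXU eqxx. Qed.

Lemma dehom_y : dehom ('X_iy : P) = 'X.
Proof. by rewrite dehom.unlock muniX_max map_polyX. Qed.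

Lemma low_or_xy (i : 'I_m.+2) : [\/ (i < m)%N, i = ix | i = iy].
Proof.
have [lt_im|] := ltnP i m; first by constructor 1.
rewrite leq_eqVlt => /orP[/eqP def_i|lt_mi]; [constructor 2 | constructor 3].
  exact: val_inj.
by apply: val_inj; apply/eqP; rewrite eqn_leq lt_mi -ltnS ltn_ord.
Qed.

Lemma dehom_kill p : dehom (kill m p) = dehom p.
Proof.
elim/mpoly_gen_ind: p => [c|i|p q IHp IHq|p q IHp IHq].
- by rewrite killC.
- by rewrite killX; case: ifP => // lt_im; rewrite dehom0 dehom_low.
- by rewrite killD !dehomD IHp IHq.
- by rewrite killM !dehomM IHp IHq.
Qed.

Definition rehom d (u : {poly K}) : P :=
  \sum_(i < d.+1) u`_i *: ('X_ix ^+ (d - i) * 'X_iy ^+ i).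

Lemma homog_rehom d u : rehom d u \is d.-homog.
Proof.
apply: rpred_sum => i _; apply: rpredZ; have := ltn_ord i; rewrite ltnS => le_id.
suff : ('X_ix : P) ^+ (d - i) * 'X_iy ^+ i \is (d - i + i).-homog by rewrite subnK.
apply: homog_XnM; by have := dhomogMn i (homog_X K iy); rewrite mul1n.
Qed.

Lemma rehomK d (u : {poly K}) : (size u <= d.+1)%N -> dehom (rehom d u) = u.
Proof.
move=> szu; rewrite dehom_sum -[RHS]coefK (poly_def) .
rewrite (big_ord_widen d.+1 (fun i => u`_i *: 'X^i)) // [RHS]big_mkcond.
apply: eq_bigr => i _; rewrite dehomZ dehomM !dehomX dehom_x dehom_y expr1n mul1r.
by case: ltnP => // le_i; rewrite nth_default ?scale0r.
Qed.

Lemma rehomD d (u v : {poly K}) : rehom d (u + v) = rehom d u + rehom d v.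
Proof. by rewrite -big_split; apply: eq_bigr => i _; rewrite coefD scalerDl. Qed.

Lemma rehom0 d : rehom d 0 = 0.
Proof. by rewrite /rehom big1 // => i _; rewrite coef0 scale0r. Qed.

Lemma rehom_dehom d p : p \is d.-homog -> rehom d (dehom p) = kill m p.
Proof.
move/dhomogP => hp; rewrite [p]mpolyE big_seq.
apply: (@big_ind _ (fun q => rehom d (dehom q) = kill m q)) => [|q1 q2 IH1 IH2|mu].
- by rewrite dehom0 kill0 rehom0.
- by rewrite dehomD killD rehomD IH1 IH2.
move/hp => deg_mu; rewrite dehomZ killZ.
suff <- : rehom d (dehom ('X_[mu] : P)) = kill m 'X_[mu].
  by rewrite /rehom scaler_sumr; apply: eq_bigr => i _; rewrite coefZ scalerA.
rewrite kill_Xm; case: ifPn => [/existsP[i /andP[lt_im mu_i]]|/existsPn mu0].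
  rewrite -dehom_kill kill_Xm ifT; last by apply/existsP; exists i; rewrite lt_im.
  by rewrite dehom0 rehom0.
have ne_yx : iy != ix by rewrite -val_eqE /= gtn_eqF.
have def_mu : 'X_[mu] = 'X_ix ^+ mu ix * 'X_iy ^+ mu iy :> P.
  rewrite mpolyXE_id (bigD1 ix) // (bigD1 iy ne_yx) /= big1 ?mulr1 // => i /andP[ne_ix ne_iy].
  have [lt_im|def_i|def_i] := low_or_xy i; last 2 first.
  - by rewrite def_i eqxx in ne_ix.
  - by rewrite def_i eqxx in ne_iy.
  by have := mu0 i; rewrite lt_im negbK => /eqP->.
have d_sum : d = (mu ix + mu iy)%N.
  rewrite -deg_mu /= mdegE (bigD1 ix) // (bigD1 iy ne_yx) /= big1 ?addn0 // => i /andP[ne_ix ne_iy].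
  have [lt_im|def_i|def_i] := low_or_xy i; last 2 first.
  - by rewrite def_i eqxx in ne_ix.
  - by rewrite def_i eqxx in ne_iy.
  by have := mu0 i; rewrite lt_im negbK => /eqP->.
rewrite def_mu dehomM !dehomX dehom_x dehom_y expr1n mul1r /rehom.
have lt_d : (mu iy < d.+1)%N by rewrite d_sum ltnS leq_addl.
rewrite (bigD1 (Ordinal lt_d)) //= coefXn eqxx scale1r big1 ?addr0.
  by rewrite d_sum addnK.
by move=> i; rewrite -val_eqE /= coefXn => /negbTE->; rewrite scale0r.
Qed.

Lemma dehom_eq0 d p : p \is d.-homog -> dehom p = 0 -> kill m p = 0.
Proof.
by move=> hp p0; rewrite -(rehom_dehom hp) p0 rehom0.
Qed.

Lemma size_dehom_leq p : (size (dehom p) <= size (muni p))%N.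
Proof. by rewrite dehom.unlock; exact: size_poly. Qed.

Lemma size_dehom p : lead_coef (muni p) \is a GRing.unit ->
  size (dehom p) = size (muni p).
Proof.
move=> Ulp; rewrite dehom.unlock; apply: size_map_poly_id0.
have /unitrPr[c lc1] := Ulp; apply/eqP => l0.
move/(congr1 (meval (fun i : 'I_m.+1 => (i == ord_max)%:R))): lc1.
by rewrite mevalM l0 mul0r meval1 => /esym/eqP; rewrite oner_eq0.
Qed.

End Dehom.

HB.lock Definition last_size (K : fieldType) (n : nat) (p : {mpoly K[n.+1]}) : nat :=
  size (muni p).

Section Gcd.
Variables (K : fieldType) (m : nat).
Local Notation P := {mpoly K[m.+2]}.
Local Notation R := {mpoly K[m.+1]}.
Local Notation ix := (widen_ord (leqnSn m.+1) ord_max : 'I_m.+2).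
Local Notation iy := (ord_max : 'I_m.+2).
Variables (N : P -> Prop) (b k : nat).
Hypothesis homN : homogeneous_ideal N.
Hypothesis regN : forall d, (b <= d)%N -> forall t : 'I_m.+2, regular_at N d t.
Hypothesis dimN : quotient_dim (in_mod N m) b k.
Variable p0 : P.
Hypotheses (Np0 : N p0) (hp0 : p0 \is b.-homog) (p0_neq0 : p0 != 0).
Implicit Types (p q : P) (d e : nat).

Let idN : is_ideal N := proj1 homN.

Lemma mpoly_mulCA (p q r : P) : p * (q * r) = q * (p * r).
Proof. exact: mulrCA. Qed.

Lemma kill_factor (t : 'I_m.+2) d q : q \is d.-homog -> kill t q != 0 ->
  exists e u, [/\ (e <= d)%N, u \is (d - e).-homog, kill t.+1 u != 0
    & kill t q = 'X_t ^+ e * kill t u].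
Proof.
elim: d q => [|d IHd] q hq q0.
  exists 0, q; rewrite subnn expr0 mul1r; split=> //.
  suff def_q : q = (q@_0)%:MP by move: q0; rewrite def_q !killC.
  apply/mpolyP => mu; rewrite mcoeffC; case: eqP => [->|ne_mu]; first by rewrite mulr1.
  rewrite mulr0 (dhomog_nemf_coeff hq) //= mdeg_eq0; exact/eqP.
have [q1|q1] := eqVneq (kill t.+1 q) 0; last first.
  by exists 0, q; rewrite subn0 expr0 mul1r.
have [u hu def_q] := kill_step_homog hq q1.
have u0 : kill t u != 0 by apply: contra_neq q0 => u0; rewrite def_q u0 mulr0.
have [e [v [le_ed hv v1 def_u]]] := IHd u hu u0.
by exists e.+1, v; rewrite subSS; split=> //; rewrite def_q def_u mulrA -exprS.
Qed.

Lemma kill_Xn_neq (r : nat) (i : 'I_m.+2) e p : (r <= i)%N ->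
  kill r ('X_i ^+ e * p) = 'X_i ^+ e * kill r p.
Proof. by move=> le_ri; rewrite killM killXn killX ltnNge le_ri. Qed.

Lemma Xn_neq0 (i : 'I_m.+2) e : 'X_i ^+ e != 0 :> P.
Proof. by rewrite expf_neq0 // mpolyX_neq0. Qed.

Lemma last_size_Xn (i : 'I_m.+2) e p : (i < m.+1)%N ->
  last_size ('X_i ^+ e * p) = last_size p.
Proof.
move=> lt_im; have -> : i = widen_ord (leqnSn m.+1) (Ordinal lt_im) by exact: val_inj.
rewrite last_size.unlock muniM rmorphXn /= muniX_widen -rmorphXn /=.
by rewrite size_Cmul // expf_neq0 // mpolyX_neq0.
Qed.

Lemma last_size_supp p q : {subset msupp p <= msupp q} ->
  (last_size p <= last_size q)%N.
Proof.
move=> sub_pq; rewrite last_size.unlock; apply/size_muni_leP => mu /sub_pq mu_q.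
by have /size_muni_leP/(_ mu mu_q) := leqnn (size (muni q)).
Qed.

(** A power of [X_t] that divides a form modulo the lower variables can be
    replaced by the same power of a later variable [X_z]: multiply by the
    latter, then cancel the former by regularity. *)
Lemma lift_mod (z : 'I_m.+2) d p : (b <= d)%N -> N p -> p \is d.-homog -> p != 0 ->
  forall s, (s <= z)%N -> exists q,
    [/\ q \is d.-homog, in_mod N s q, kill s q != 0
      & (z < m.+1)%N -> (last_size (kill s q) <= last_size p)%N].
Proof.
move=> le_bd Np hp p_neq0; elim=> [|s IHs] lt_sz.
  by exists p; rewrite kill_none; split=> //; exact: in_mod_incl.
have [q [hq Nq q0 szq]] := IHs (ltnW lt_sz).
have lt_sm : (s < m.+2)%N := ltn_trans lt_sz (ltn_ord z).
pose t := Ordinal lt_sm.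
have [e [u [le_ed hu u1 def_q]]] := kill_factor (t := t) hq q0.
have hq' : 'X_z ^+ e * u \is d.-homog by rewrite -(subnKC le_ed); exact: homog_XnM.
have le_tz : (t <= z)%N := ltnW lt_sz.
have Nq' : in_mod N t ('X_z ^+ e * u).
  apply: (@regular_iter _ _ N d t e) => // [d' le_dd'|].
    by apply: regN; exact: leq_trans le_dd'.
  have [a Na eq_aq] := Nq; exists ('X_z ^+ e * a); first exact: ideal_mull.
  rewrite !kill_Xn_neq // eq_aq -[kill s q]/(kill t q) def_q.
  exact: mpoly_mulCA.
exists ('X_z ^+ e * u); split.
- exact: hq'.
- exact: (in_mod_leq (leqnSn t) Nq').
- by rewrite kill_Xn_neq // mulf_neq0 // Xn_neq0.
move=> lt_zm; apply: leq_trans (szq lt_zm).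
have lt_tm : (t < m.+1)%N := ltn_trans lt_sz lt_zm.
rewrite -[kill s q]/(kill t q) def_q (last_size_Xn e (kill t u) lt_tm).
rewrite -[kill s.+1 _]/(kill t.+1 _) (kill_Xn_neq e u lt_sz).
rewrite (last_size_Xn e (kill t.+1 u) lt_zm) -(kill_kill u (leqnSn t)).
by apply: last_size_supp; exact: msupp_kill.
Qed.

Lemma mdeg_rcons (mu : 'X_{1..m.+1}) i :
  mdeg [multinom of rcons mu i] = (mdeg mu + i)%N.
Proof.
rewrite !mdegE big_ord_recr /= mnm_rconsE nth_default ?size_tuple //.
congr (_ + _)%N; apply: eq_bigr => j _; rewrite mnm_rconsE /=.
by rewrite [RHS](mnm_nth i).
Qed.

(** Lifting along all variables but the last turns [p0] into a form of degree [b]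
    in [N] that contains the power of degree [b] of the last variable. *)
Lemma exists_monic : exists f, [/\ N f, msize f = b.+1, size (muni f) = b.+1
  & lead_coef (muni f) \is a GRing.unit].
Proof.
have [q [hq Nq q0 _]] := lift_mod (leqnn b) Np0 hp0 p0_neq0 (leqnn iy).
have [f [Nf hf eq_fq]] := in_mod_homog homN hq Nq; rewrite -eq_fq in q0.
have f0 : f != 0 by apply: contra_neq q0 => ->; rewrite kill0.
have szf : msize f = b.+1.
  rewrite (dhomog_uniq f0 hf (dhomog_msize hf)) prednK //.
  by rewrite lt0n msize_poly_eq0.
have [mu mu_f mu_low] : exists2 mu, mu \in msupp f & forall i : 'I_m.+2, (i < m.+1)%N -> mu i = 0%N.
  have lead_f := mlead_supp q0; exists (mlead (kill m.+1 f)).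
    exact: msupp_kill lead_f.
  move: lead_f; rewrite mcoeff_msupp mcoeff_kill.
  case: ifPn; rewrite ?eqxx // => /existsPn low _ i lt_im.
  by have := low i; rewrite lt_im negbK => /eqP.
have mu_y : mu iy = b.
  rewrite -(dhomog_mf hf mu_f) /= mdegE (bigD1 iy) //= big1 ?addn0 // => i ne_iy.
  by apply: mu_low; rewrite ltn_neqAle -ltnS ltn_ord andbT.
have szuf : size (muni f) = b.+1.
  apply/eqP; rewrite eqn_leq -{1}szf size_muni_msize /= ltnNge.
  by apply/negP => /size_muni_leP/(_ mu mu_f); rewrite mu_y ltnn.
exists f; split=> //; rewrite lead_coefE szuf /=.
have lead0 : (muni f)`_b != 0.
  have : lead_coef (muni f) != 0 by rewrite lead_coef_eq0 muni_eq0.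
  by rewrite lead_coefE szuf.
have def_lead : (muni f)`_b = ((muni f)`_b@_0)%:MP.
  apply/mpolyP => nu; rewrite mcoeffC; case: eqP => [->|ne_nu]; first by rewrite mulr1.
  rewrite mulr0 coef_muni (dhomog_nemf_coeff hf) //= mdeg_rcons.
  by rewrite -[X in _ != X]add0n eqn_add2r mdeg_eq0; exact/eqP.
rewrite def_lead in lead0 *; apply/unitrPr.
exists ((muni f)`_b@_0)^-1%:MP; rewrite -mpolyCM divff //.
by apply: contra_neq lead0 => ->.
Qed.

(** The quotient of the forms of degree [b] by [N + (X_0, ..., X_{m-1})]
    becomes, after dehomogenisation, the space of remainders modulo the
    generator of the image of [N]. *)
Definition residue (q0 : {poly K}) (p : dhomog m.+2 K b) : 'rV[K]_(size q0).-1 :=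
  poly_rV (dehom (p : P) %% q0).

Lemma residue_linear (q0 : {poly K}) : linear (residue q0).
Proof. by move=> c p q; rewrite /residue dehomD dehomZ modpD modpZl linearP. Qed.

HB.instance Definition _ (q0 : {poly K}) := GRing.isLinear.Build K (dhomog m.+2 K b)
  'rV[K]_(size q0).-1 _ (residue q0) (residue_linear q0).

Lemma in_mod_dehom q : q \is b.-homog -> (exists2 a, N a & dehom a = dehom q) ->
  in_mod N m q.
Proof.
move=> hq [a Na eq_aq].
(* multiplied by suitable powers of x, the components of a and q get the
   same degree, where dehomogenisation is injective modulo the first m
   variables *)
pose e := msize a.
pose c := 'X_ix ^+ e * q -
  \sum_(d < msize a) 'X_ix ^+ (e + b - d) * pihomog mdeg d a.
have hc : c \is (e + b).-homog.
  apply: rpredB; first exact: homog_XnM.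
  apply: rpred_sum => d _.
  have le_d : (d <= e + b)%N by apply: leq_trans (ltnW (ltn_ord d)) (leq_addr _ _).
  have := homog_XnM ix (e + b - d) (pihomogP mdeg d a); by rewrite subnK.
have c0 : dehom c = 0.
  rewrite dehomB dehom_sum dehomM dehomX dehom_x expr1n mul1r -eq_aq.
  rewrite {1}[a]pihomog_sum dehom_sum; apply/eqP; rewrite subr_eq0; apply/eqP.
  by apply: eq_bigr => d _; rewrite dehomM dehomX dehom_x expr1n mul1r.
apply: (@regular_iter _ _ N b ix e) => //; first by move=> d le_bd; exact: regN.
exists (\sum_(d < msize a) 'X_ix ^+ (e + b - d) * pihomog mdeg d a).
  by apply: ideal_sum => // d _; apply: ideal_mull => //; exact: (proj2 homN).
have /eqP := dehom_eq0 hc c0; rewrite killB subr_eq0 => /eqP eq_kill.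
by rewrite -[val ix]/m -eq_kill.
Qed.

(** The image of [N] is an ideal of [K[y]].  Its generator has degree [k] because
    the remainders modulo it realise the quotient of dimension [k]; all of
    them are reached from degree [b], as the image contains a polynomial of
    degree [b]. *)
Lemma dehom_generator : exists q0 : {poly K}, [/\ size q0 = k.+1,
  forall p, N p -> divides q0 (dehom p) & exists2 a, N a & dehom a = q0].
Proof.
have [f [Nf _ szf Uf]] := exists_monic.
have dehom_surj (u : {poly K}) : exists a : P, dehom a = u.
  by exists (rehom m (size u) u); rewrite rehomK.
have [|s [a [Na a0 sza]] min_s] := @least_nat (fun e : nat =>
    exists a, [/\ N a, dehom a != 0 & size (dehom a) = e]).
  by exists b.+1, f; rewrite -size_poly_eq0 size_dehom // szf.
pose q0 := dehom a.
have q0_divides p : N p -> q0 %| dehom p.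
  move=> Np; apply/modp_eq0P/eqP/negPn/negP => r0; have := ltn_modpN0 (dehom p) a0.
  apply/negP; rewrite -leqNgt sza; apply: min_s.
  have [c def_c] := dehom_surj (dehom p %/ q0).
  exists (p - c * a); rewrite dehomB dehomM def_c.
  have -> : dehom p - dehom p %/ q0 * dehom a = dehom p %% q0.
    by rewrite {1}(divp_eq (dehom p) q0) addrC addKr.
  by split=> //; apply: ideal_subr => //; exact: ideal_mull.
have szq0 : (0 < size q0)%N by rewrite size_poly_gt0.
have le_s : ((size q0).-1 <= b)%N.
  rewrite -ltnS prednK // -szf -size_dehom //.
  by apply: dvdp_leq (q0_divides f Nf); rewrite -size_poly_eq0 size_dehom // szf.
exists q0; split=> [|p Np|]; last by exists a.
  rewrite -(prednK szq0); congr _.+1; apply: quotient_dim_unique dimN.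
  have sz_mod (u : {poly K}) : (size (u %% q0)%R <= (size q0).-1)%N by rewrite -ltnS prednK // ltn_modp.
  exists (residue q0) => [v|p].
    have szv : (size (rVpoly v) <= b.+1)%N.
      by apply: leq_trans (size_poly _ _) _; exact: leqW.
    exists (DHomog (homog_rehom m b (rVpoly v))) => /=.
    rewrite /residue /= rehomK // modp_small ?rVpolyK //.
    by apply: leq_ltn_trans (size_poly _ _) _; rewrite prednK.
  split=> [res0|[c Nc eq_cp]].
    apply: in_mod_dehom; first exact: dhomog_is_dhomog.
    have : q0 %| dehom (p : P).
      apply/modp_eq0P; rewrite -(poly_rV_K (sz_mod _)).
      by rewrite -[poly_rV _]/(residue q0 p) [residue _ _]res0 linear0.
    move/dvdpP => [u def_p]; have [c def_c] := dehom_surj u.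
    by exists (c * a); [exact: ideal_mull | rewrite dehomM def_c def_p].
  rewrite /= /residue -(dehom_kill (p : P)) -eq_cp dehom_kill.
  by rewrite (modp_eq0P _ _ (q0_divides c Nc)) linear0.
by have /dvdpP[u ->] := q0_divides p Np; exists u.
Qed.

(** Lifting moves a nonzero element of [N] to one that is nonzero in the plane of
    the last two variables, without raising its degree in the last variable;
    there the degree is at least that of the generator of the image of [N]. *)
Lemma size_muni_ge p : N p -> p != 0 -> (k < size (muni p))%N.
Proof.
move=> Np p_neq0; have [q0 [szq0 q0_div _]] := dehom_generator.
have [d pd_neq0] : exists d, pihomog mdeg d p != 0.
  apply: NNPP => noP; case/eqP: p_neq0; rewrite [p]pihomog_sum big1 // => d _.
  by apply/eqP/negPn/negP => pd; apply: noP; exists d.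
pose q := 'X_ix ^+ b * pihomog mdeg d p.
have hq : q \is (b + d).-homog by apply: homog_XnM; exact: pihomogP.
have Nq : N q by apply: ideal_mull => //; exact: (proj2 homN).
have q_neq0 : q != 0 by rewrite mulf_neq0 // Xn_neq0.
have [u [hu Nu u_neq0 szu]] := lift_mod (leq_addr d b) Nq hq q_neq0 (leqnn ix).
have [c Nc eq_cu] := Nu.
have u1 : dehom u != 0 by apply: contra_neq u_neq0; exact: dehom_eq0 hu.
have [w def_w] := q0_div c Nc; rewrite -dehom_kill -[m]/(val ix) eq_cu dehom_kill in def_w.
rewrite -szq0; apply: (@leq_trans (size (dehom u))).
  by apply: dvdp_leq => //; apply/dvdpP; exists w.
rewrite -dehom_kill; apply: leq_trans (size_dehom_leq _) _.
apply: leq_trans (_ : last_size (kill m u) <= _)%N; first by rewrite last_size.unlock.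
apply: leq_trans (szu (leqnn _)) _; rewrite /q last_size_Xn //.
apply: leq_trans (_ : last_size p <= _)%N; last by rewrite last_size.unlock.
apply: last_size_supp => mu; rewrite !mcoeff_msupp mcoeff_pihomog => mu_pd.
by apply: contra_neq mu_pd => ->; rewrite mul0rn.
Qed.

Fact tight_sizes (l x y z : nat) : (z <= x)%N -> (l.+1 <= y)%N ->
  b.+1 = (x + y).-1 -> b.+1 = (z + l.+1).-1 -> (0 < z)%N -> y = l.+1.
Proof. clear; lia. Qed.

(** An element [p] of [N] of least degree in the last variable divides every
    element of [N] up to a factor free of that variable.  Applied to the [f]
    of [exists_monic], the Gauss lemma extracts from [p] a factor [G] that divides [f] and
    differs from [p] by such a factor.  As a divisor of [f], [G] has an
    invertible leading coefficient, so these factors can be cancelled: [G]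
    divides all of [N], and every common divisor of [N] divides [G].  The degree
    of [G] is at least [k] by [size_muni_ge], and at most [k] because the image
    of [G] divides the generator of the image of [N]. *)
Lemma exists_gcd : exists2 g, is_gcd N g & msize g = k.+1.
Proof.
have [f [Nf mszf szf Uf]] := exists_monic.
have f0 : f != 0 by rewrite -muni_eq0 -size_poly_eq0 szf.
have [|s [p [Np p_neq0 szp]] min_s] := @least_nat (fun e : nat =>
    exists p, [/\ N p, p != 0 & size (muni p) = e]).
  by exists b.+1, f.
have up0 : muni p != 0 by rewrite muni_eq0.
have p_divides q : N q -> exists2 c, c != 0 & divides (muni p) (c%:P * muni q).
  move=> Nq; exists (lead_coef (muni p) ^+ scalp (muni q) (muni p)).
    by rewrite expf_neq0 // lead_coef_eq0.
  exists (muni q %/ muni p); have := Pdiv.Idomain.divp_eq (muni q) (muni p).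
  rewrite -mul_polyC => def_r; rewrite {}def_r.
  suff -> : muni q %% muni p = 0 by rewrite addr0.
  apply/eqP/negPn/negP => r0; have := ltn_modpN0 (muni q) up0.
  apply/negP; rewrite -leqNgt szp; apply: min_s.
  exists (unimulti (muni q %% muni p)); rewrite unimultiK; split=> //.
    have def_r := Pdiv.Idomain.divp_eq (muni q) (muni p).
    have -> : unimulti (muni q %% muni p) =
        unimulti (lead_coef (muni p) ^+ scalp (muni q) (muni p))%:P * q
        - unimulti (muni q %/ muni p) * p.
      apply: (can_inj (@muniK K m.+1)).
      by rewrite muniB !muniM !unimultiK mul_polyC def_r addrC addKr.
    by apply: ideal_subr => //; exact: ideal_mull.
  by rewrite -muni_eq0 unimultiK.
have [c c0 [a def_f]] := p_divides f Nf.
have [c1 [c2 [a' [G [_ _ def_p def_f']]]]] := gauss (@factorial_ring_mpoly K m.+1) c0 def_f.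
have c2_0 : c2 != 0 by apply: contra_neq up0 => e0; rewrite def_p e0 mul0r.
have UG : lead_coef G \is a GRing.unit.
  by move: Uf; rewrite def_f' lead_coefM unitrM => /andP[].
have G0 : G != 0 by apply: contra_neq up0 => e0; rewrite def_p e0 mulr0.
have a'0 : a' != 0.
  by apply: contra_neq f0 => e0; apply/eqP; rewrite -muni_eq0 def_f' e0 mul0r.
have [g def_g] : exists g : P, muni g = G by exists (unimulti G); exact: unimultiK.
have [h def_h] : exists h : P, muni h = a' by exists (unimulti a'); exact: unimultiK.
have def_fg : f = h * g.
  by apply: (can_inj (@muniK K m.+1)); rewrite def_f' muniM def_g def_h.
have szG : size (muni g) = size G by rewrite def_g.
have g_divides q : N q -> divides g q.
  move=> Nq; have [e e0 [w def_w]] := p_divides q Nq.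
  apply/divides_muni; rewrite def_g; apply: unit_lead_divides UG e0 _.
  by exists (w * c2%:P); rewrite def_w def_p mulrA.
have szGk : size G = k.+1.
  apply/eqP; rewrite eqn_leq; apply/andP; split.
    have [q0 [szq0 _ [d Nd def_q0]]] := dehom_generator.
    have d0 : dehom d != 0 by rewrite -size_poly_eq0 def_q0 szq0.
    have Ug : lead_coef (muni g) \is a GRing.unit by rewrite def_g.
    rewrite -szq0 -(etrans (size_dehom Ug) szG) -def_q0.
    apply: (dvdp_leq d0); have [w ->] := g_divides d Nd; rewrite dehomM.
    exact: dvdp_mull.
  rewrite -(size_Cmul _ c2_0) -def_p; exact: size_muni_ge.
exists g.
  split; [exact: g_divides | move=> q q_div]; apply/divides_muni; rewrite def_g.
  have q_p : divides (muni q) (c2%:P * G).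
    by rewrite -def_p; exact: (proj2 (divides_muni q p) (q_div p Np)).
  apply: (unit_lead_divides _ c2_0 q_p).
  have [w def_w] := proj2 (divides_muni q f) (q_div f Nf).
  by move: Uf; rewrite def_w lead_coefM unitrM => /andP[].
(* f = h g has the same degree in the last variable as in total, so both
   factors do *)
have g0 : g != 0 by rewrite -muni_eq0 def_g.
have h0 : h != 0 by rewrite -muni_eq0 def_h.
have szh : size (muni h) = size a' by rewrite def_h.
have le_h : (size a' <= msize h)%N := leq_trans (eq_leq (esym szh)) (size_muni_msize h).
have le_g : (k.+1 <= msize g)%N :=
  leq_trans (eq_leq (esym (etrans szG szGk))) (size_muni_msize g).
have sum_msize : b.+1 = (msize h + msize g).-1.
  exact: etrans (esym mszf) (etrans (congr1 (fun q : P => msize q) def_fg) (msizeM h0 g0)).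
have sum_size : b.+1 = (size a' + k.+1).-1.
  rewrite -szGk; exact: etrans (esym szf) (etrans (congr1 (fun u : {poly R} => size u) def_f') (size_mul a'0 G0)).
have a'_gt0 : (0 < size a')%N by rewrite size_poly_gt0.
exact: tight_sizes le_h le_g sum_msize sum_size a'_gt0.
Qed.

End Gcd.

Import passmx.

(** * Generic points *)

Section LineOpen.
Variable K : fieldType.
Hypothesis charK : [pchar K] =i pred0.

Lemma natr_inj_char0 : injective (fun i : nat => i%:R : K).
Proof.
suff le_inj i j : (i <= j)%N -> i%:R = j%:R :> K -> i = j.
  by move=> i j; case/orP: (leq_total i j) => [/le_inj //|/le_inj inj /esym/inj].
move=> le_ij eq_ij; have /eqP := subrr (j%:R : K); rewrite -{2}eq_ij -natrB //.
by rewrite (proj1 (pcharf0P K) charK) subn_eq0 => le_ji; apply/eqP; rewrite eqn_leq le_ij.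
Qed.

Lemma exists_nonroot (q : {poly K}) : q != 0 -> exists t, q.[t] != 0.
Proof.
move=> q0; apply: NNPP => no_t.
have: (size [seq i%:R : K | i <- iota 0 (size q)] < size q)%N.
  apply: max_poly_roots q0 _ _.
    apply/allP => t _; rewrite /root; apply/negPn/negP => qt.
    by apply: no_t; exists t.
  by rewrite (map_inj_uniq natr_inj_char0) iota_uniq.
by rewrite size_map size_iota ltnn.
Qed.

Lemma exists_nonroots (q : {poly K}) e : q != 0 ->
  exists ts : e.-tuple K, uniq ts /\ forall t, t \in ts -> q.[t] != 0.
Proof.
move=> q0; elim: e => [|e [ts [uts tsP]]]; first by exists [tuple].
have [|t] := @exists_nonroot (q * \prod_(s <- ts) ('X - s%:P)).
  by rewrite mulf_neq0 // monic_neq0 // monic_prod_XsubC.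
rewrite hornerM mulf_eq0 negb_or => /andP[qt /negP t_ts].
exists [tuple of t :: ts]; split=> [|s]; rewrite /= ?in_cons.
  by rewrite uts andbT; apply/negP => t_in; apply/t_ts/eqP/rootP; rewrite root_prod_XsubC.
by case/orP => [/eqP->|/tsP].
Qed.

(** All that is used of Zariski open sets: a line through a point of the set
    stays in the set except at the roots of a polynomial. *)
Definition line_open (E : lmodType K) (U : E -> Prop) : Prop :=
  forall A B, U A -> exists2 q : {poly K}, q.[0] != 0
    & forall t, q.[t] != 0 -> U (A + t *: B).

Section Lines.
Variable E : lmodType K.
Implicit Types U : E -> Prop.

Lemma horner0_neq0 (q : {poly K}) : q.[0] != 0 -> q != 0.
Proof. by apply: contra_neq => ->; rewrite horner0. Qed.

Lemma line_swap (A B : E) t : B + (1 - t) *: (A - B) = A + t *: (B - A).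
Proof. by rewrite scalerBl scale1r addrA subrKC -scalerN opprB. Qed.

Lemma line_open_meet U1 U2 : line_open U1 -> line_open U2 ->
  line_open (fun A => U1 A /\ U2 A).
Proof.
move=> open1 open2 A B [/open1-/(_ B)[q1 q10 q1P] /open2-/(_ B)[q2 q20 q2P]].
exists (q1 * q2) => [|t]; first by rewrite hornerM mulf_neq0.
by rewrite hornerM mulf_eq0 negb_or => /andP[/q1P + /q2P].
Qed.

Lemma line_open_nonempty_meet U1 U2 : line_open U1 -> line_open U2 ->
  (exists A, U1 A) -> (exists A, U2 A) -> exists A, U1 A /\ U2 A.
Proof.
move=> open1 open2 [A UA] [B UB].
have [q1 q10 q1P] := open1 A (B - A) UA; have [q2 q20 q2P] := open2 B (A - B) UB.
have q2'0 : q2 \Po (1 - 'X) != 0.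
  apply: contra_neq q20 => q2'0.
  have: (q2 \Po (1 - 'X)).[1] = 0 by rewrite q2'0 horner0.
  by rewrite horner_comp !hornerE subrr.
have [|t] := @exists_nonroot (q1 * (q2 \Po (1 - 'X))).
  by rewrite mulf_neq0 // horner0_neq0.
rewrite hornerM mulf_eq0 negb_or => /andP[/q1P U1t].
rewrite horner_comp !hornerE => /q2P U2t; exists (A + t *: (B - A)); split=> //.
by rewrite -line_swap.
Qed.

Lemma line_open_all (T : eqType) (s : seq T) (U : T -> E -> Prop) :
  (forall i, i \in s -> line_open (U i) /\ exists A, U i A) ->
  line_open (fun A => forall i, i \in s -> U i A) /\
  exists A, forall i, i \in s -> U i A.
Proof.
elim: s => [_|i s IHs sU]; first by split=> [A B _|]; [exists 1; rewrite ?hornerC ?oner_neq0 | exists 0].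
have [|openS exS] := IHs; first by move=> j js; apply: sU; rewrite in_cons js orbT.
have [openi exi] := sU i (mem_head i s); split; last first.
  have [A [Ai As]] := line_open_nonempty_meet openi openS exi exS; exists A => j.
  by rewrite in_cons => /orP[/eqP->|/As].
move=> A B sA; have [|q q0 qP] := line_open_meet openi openS (A := A) B.
  by split=> [|j js]; apply: sA; rewrite ?mem_head // in_cons js orbT.
exists q => // t /qP[Ui Us] j; by rewrite in_cons => /orP[/eqP->|/Us].
Qed.

End Lines.

Lemma line_open_preim (E F : lmodType K) (f : E -> F) (U : F -> Prop) :
  (forall A t B, f (A + t *: B) = f A + t *: f B) ->
  line_open U -> line_open (fun A => U (f A)).
Proof.
move=> fL openU A B /openU-/(_ (f B))[q q0 qP]; exists q => // t /qP.
by rewrite fL.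
Qed.

Lemma meval_line n (F : {mpoly K[n]}) (v w : 'I_n -> K) :
  exists q : {poly K}, forall t, q.[t] = F.@[fun i => v i + t * w i].
Proof.
elim/mpoly_gen_ind: F => [c|i|p q [x xP] [y yP]|p q [x xP] [y yP]].
- by exists c%:P => t; rewrite hornerC mevalC.
- by exists ((v i)%:P + (w i) *: 'X) => t; rewrite mevalXU !hornerE mulrC.
- by exists (x + y) => t; rewrite hornerD xP yP mevalD.
- by exists (x * y) => t; rewrite hornerM xP yP mevalM.
Qed.

Lemma zariski_line_open n r (U : 'M[K]_(r, n) -> Prop) :
  zariski_open U -> line_open U.
Proof.
move=> [S US] A B /US[F SF FA].
have [q qP] := meval_line F (fun e => mxvec A ord0 e) (fun e => mxvec B ord0 e).
exists q => [|t].
  by rewrite qP; move: FA; congr (_ != 0); apply: meval_eq => i; rewrite mul0r addr0.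
rewrite qP => Ft; apply/US; exists F => //; move: Ft; congr (_ != 0).
by apply: meval_eq => i; rewrite linearD linearZ !mxE.
Qed.

Lemma unitmx_line_open n : line_open (fun A : 'M[K]_n => A \in unitmx).
Proof.
move=> A B; rewrite unitmxE unitfE => detA.
have det_line t : (\det (map_mx polyC A + 'X *: map_mx polyC B)).[t] = \det (A + t *: B).
  rewrite -horner_evalE -det_map_mx; congr (\det _).
  by apply/matrixP => i j; rewrite !mxE /= !horner_evalE hornerD hornerM hornerX !hornerC.
exists (\det (map_mx polyC A + 'X *: map_mx polyC B)) => [|t].
  by rewrite det_line scale0r addr0.
by rewrite det_line unitmxE unitfE.
Qed.

End LineOpen.

(** * The sectional matrix *)

Section GenericRank.
Variables (K : fieldType) (N p q : nat) (M : 'M[{mpoly K[N]}]_(p, q)).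

(** The rank is maximal wherever a maximal minor of a point of maximal rank
    does not vanish. *)
Lemma generic_rank : exists (rho : nat) (F : {mpoly K[N]}),
  (exists v, F.@[v] != 0) /\
  forall v, F.@[v] != 0 -> \rank (map_mx (meval v) M) = rho.
Proof.
have [|e [v def_e] min_e] :=
    @least_nat (fun e => exists v, (p - \rank (map_mx (meval v) M))%N = e).
  by exists (p - \rank (map_mx (meval (fun _ => 0%R)) M))%N, (fun _ => 0%R).
pose X := map_mx (meval v) M; pose f := maxrankfun X.
have fullXT : row_full (rowsub f X)^T.
  by rewrite /row_full mxrank_tr; exact: maxrowsub_free.
pose g := fullrankfun fullXT.
pose minor (R : Type) (Y : 'M[R]_(p, q)) := rowsub g (rowsub f Y)^T.
have minorE w : map_mx (meval w) (minor _ M) = minor _ (map_mx (meval w) M).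
  by rewrite /minor map_mxsub -map_trmx map_mxsub.
exists (\rank X), (\det (minor _ M)); split.
  exists v; rewrite -det_map_mx minorE -unitfE -unitmxE; exact: fullrowsub_unit.
move=> w; rewrite -det_map_mx minorE -unitfE -unitmxE => unit_w.
have le_p (Z : 'M[K]_(p, q)) : (\rank Z <= p)%N := rank_leq_row Z.
apply/eqP; rewrite eqn_leq; apply/andP; split.
  have /min_e : exists w', (p - \rank (map_mx (meval w') M) = p - \rank (map_mx (meval w) M))%N.
    by exists w.
  by rewrite -def_e; have := le_p X; have := le_p (map_mx (meval w) M); rewrite /X; lia.
rewrite -(mxrank_unit unit_w); apply: leq_trans (mxrankS (rowsub_sub _ _)) _.
by rewrite mxrank_tr; exact: mxrankS (rowsub_sub _ _).
Qed.

End GenericRank.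

Section SectionalMatrix.
Variables (K : fieldType) (n : nat).
Local Notation P := {mpoly K[n.+1]}.
Local Notation V d := (dhomog n.+1 K d).
Implicit Types (I : P -> Prop).

(** A subspace of largest dimension among those contained in [Q]. *)
Lemma predicate_vspace (vT : vectType K) (Q : vT -> Prop) :
  Q 0 -> (forall c u v, Q u -> Q v -> Q (c *: u + v)) ->
  exists U : {vspace vT}, forall v, v \in U <-> Q v.
Proof.
move=> Q0 Qlin; have [|e [U [UQ def_e]] min_e] := @least_nat (fun e =>
    exists U : {vspace vT}, (forall v, v \in U -> Q v) /\ (\dim {:vT} - \dim U)%N = e).
  by exists (\dim {:vT} - \dim (0 : {vspace vT}))%N, 0%VS; split=> // v; rewrite memv0 => /eqP->.
exists U => v; split=> [/UQ //|Qv]; apply: contraT => vU.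
have W_Q u : u \in (U + <[v]>)%VS -> Q u.
  case/memv_addP => u1 Uu1 [_ /vlineP[c ->] ->]; rewrite addrC; apply: Qlin => //.
  exact: UQ.
have lt_dim : (\dim U < \dim (U + <[v]>))%N.
  rewrite ltn_neqAle (dimvS (addvSl _ _)) andbT.
  rewrite (dimv_leqif_eq (addvSl _ _)); apply: contra vU => /eqP->.
  exact: (subvP (addvSr U <[v]>) v (memv_line v)).
have := min_e _ (ex_intro _ _ (conj W_Q erefl)).
have := dimvS (subvf (U + <[v]>)); have := dimvS (subvf U); lia.
Qed.

(** Here [(J A)_d] is spanned by finitely many vectors whose coordinates are
    polynomials in the entries of [A], so its dimension is the rank of a matrix
    of polynomials. *)
Lemma generic_quotient r d (T : finType) (w : 'M[K]_(r, n.+1) -> T -> V d)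
    (F : T -> 'I_(\dim {:V d}) -> {mpoly K[r * n.+1]})
    (J : 'M[K]_(r, n.+1) -> P -> Prop) :
  (forall A t c, coord (vbasis {:V d}) c (w A t) = (F t c).@[fun e => mxvec A ord0 e]) ->
  (forall A (p : V d), J A p <-> exists a : T -> K, p = \sum_t a t *: w A t) ->
  exists e, generically (fun A => quotient_dim (J A) d e).
Proof.
move=> wF JP; set D := \dim {:V d} in F wF *.
pose M := \matrix_(i < #|T|, c < D) F (enum_val i) c.
have [rho [G [[v Gv] rankM]]] := generic_rank M.
exists (D - rho)%N, (fun A => G.@[fun e => mxvec A ord0 e] != 0); split.
- exists (fun q => q = G) => A; split=> [GA|[_ ->] //]; by exists G.
- exists (vec_mx (\row_e v e)); move: Gv; congr (_ != 0); apply: meval_eq => e.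
  by rewrite vec_mxK mxE.
move=> A /rankM; set MA := map_mx _ M => rkMA.
have rk_coker : \rank (cokermx MA) = (D - rho)%N by rewrite mxrank_coker rkMA.
rewrite -rk_coker; have basisV : basis_of {:V d} (vbasis {:V d}) := vbasisP _.
pose C := cokermx MA.
pose f : {linear V d -> 'rV[K]_(\rank C)} := mulmxr (col_base C) \o rVof (vbasis {:V d}).
exists f => [x|p].
  exists (vecof (vbasis {:V d}) (x *m pinvmx (col_base C))).
  by rewrite /f /= vecofK // -mulmxA (mulVpmx (col_base_full C)) mulmx1.
have rowMA t : row (enum_rank t) MA = rVof (vbasis {:V d}) (w A t).
  by apply/rowP => c; rewrite !mxE enum_rankK wF.
have -> : (f p = 0) <-> (rVof (vbasis {:V d}) p <= MA)%MS.
  rewrite submxE -/C -[in X in _ <-> X](mulmx_base C) mulmxA; split=> [fp0|/eqP ker_p].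
    by rewrite [_ *m col_base C]fp0 mul0mx.
  by apply: (row_free_inj (row_base_free C)); rewrite /= mul0mx.
rewrite JP; split=> [/submxP[x def_p]|[a def_p]].
  exists (fun t => x 0 (enum_rank t)); apply: (can_inj (rVofK basisV)).
  rewrite def_p mulmx_sum_row linear_sum (reindex (@enum_rank T)) /=; last first.
    by apply: onW_bij; exact: enum_rank_bij.
  by apply: eq_bigr => t _; rewrite linearZ rowMA.
rewrite def_p linear_sum; apply: summx_sub => t _.
by rewrite linearZ /=; apply: scalemx_sub; rewrite -rowMA row_sub.
Qed.

End SectionalMatrix.

Section SectionalMatrixSpec.
Variables (K : fieldType) (n : nat).
Local Notation P := {mpoly K[n.+1]}.
Local Notation V d := (dhomog n.+1 K d).
Implicit Types (I : P -> Prop).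

Definition lin_form r (A : 'M[K]_(r, n.+1)) (j : 'I_r) : P :=
  \sum_(k < n.+1) A j k *: 'X_k.

Lemma homog_lin_form r (A : 'M[K]_(r, n.+1)) j : lin_form A j \is 1.-homog.
Proof. by apply: rpred_sum => k _; apply: rpredZ; exact: homog_X. Qed.

Lemma linear_forms_is_ideal r (A : 'M[K]_(r, n.+1)) : is_ideal (linear_forms_ideal A).
Proof. exact: ideal_gen_ideal. Qed.

(** The multipliers of the linear forms can be taken in degree [d - 1], which
    makes the degree [d] part of the sum a space spanned by finitely many
    vectors; in degree 0 there are no multipliers. *)
Lemma ideal_add_homog I r (A : 'M[K]_(r, n.+1)) d p :
  homogeneous_ideal I -> p \is d.-homog ->
  ideal_add I (linear_forms_ideal A) p <->
  exists a (v : 'I_r -> P), [/\ I a, a \is d.-homog,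
    forall j, (if d is e.+1 then v j \is e.-homog else v j == 0)
    & p = a + \sum_j v j * lin_form A j].
Proof.
move=> homI hp; have idI := proj1 homI; split; last first.
  move=> [a [v [Ia _ _ ->]]]; exists a, (\sum_j v j * lin_form A j); split=> //.
  apply: ideal_sum (linear_forms_is_ideal A) _ _ _ _ _ => j _.
  by apply: ideal_mull (linear_forms_is_ideal A) _ _ _; apply: ideal_gen_incl; exists j.
move=> [a [l [Ia [s sL def_l] def_p]]].
have [v vh def_ld] : exists2 v : 'I_r -> P,
    forall j, (if d is e.+1 then v j \is e.-homog else v j == 0)
  & pihomog mdeg d l = \sum_j v j * lin_form A j.
  rewrite {}def_l linear_sum /=; elim: s sL => [|u s IHs] sL.
    exists (fun _ => 0) => [j|]; first by case: d {hp def_p} => // e; exact: rpred0.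
    by rewrite big_nil big1 // => j _; rewrite mul0r.
  have [|v vh def_v] := IHs; first by move=> x xs; apply: sL; rewrite in_cons xs orbT.
  have [j def_u] := sL u (mem_head u s); rewrite -/(lin_form A j) in def_u.
  have hu := homog_lin_form A j; rewrite -def_u in hu.
  rewrite big_cons def_v; case: d {hp def_p IHs def_v} vh => [|e] vh.
    by exists v => //; rewrite (pihomogM_lt _ hu) ?add0r.
  exists (fun i => v i + pihomog mdeg e u.1 *+ (i == j)) => [i|].
    apply: rpredD => //; case: (i == j); [exact: pihomogP | exact: rpred0].
  rewrite -[e.+1]addn1 (pihomogM _ _ hu) def_u addrC.
  under [RHS]eq_bigr do rewrite mulrDl.
  rewrite big_split /=; congr (_ + _).
  rewrite (bigD1 j) //= eqxx mulr1n big1 ?addr0 // => i /negbTE->.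
  by rewrite mulr0n mul0r.
exists (pihomog mdeg d a), v; split=> //; first exact: (proj2 homI).
  exact: pihomogP.
by rewrite -def_ld -linearD /= -def_p pihomog_dE.
Qed.

Definition xmul d (k : 'I_n.+1) (q : V d) : V d.+1 :=
  DHomog (homog_XM k (dhomog_is_dhomog q)).

Lemma exists_generic_dim I r d : homogeneous_ideal I ->
  exists e, generically (fun A : 'M[K]_(r, n.+1) =>
    quotient_dim (ideal_add I (linear_forms_ideal A)) d e).
Proof.
move=> homI; have idI := proj1 homI.
have [|c p q Ip Iq|U UI] := @predicate_vspace K (V d) (fun p : V d => I p).
- exact: ideal_zero.
- by apply: ideal_addr => //=; rewrite -mul_mpolyC; exact: ideal_mull.
have inU (p : P) (hp : p \is d.-homog) : I p -> exists a : 'I_(\dim U) -> K,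
    p = \sum_i a i *: ((vbasis U)`_i : P).
  move=> Ip; have /coord_vbasis def_p : (DHomog hp : V d) \in U by apply/UI.
  exists (fun i => coord (vbasis U) i (DHomog hp)).
  by have := congr1 (@mpoly_of_dhomog _ _ _) def_p; rewrite linear_sum.
have IU (i : 'I_(\dim U)) : I ((vbasis U)`_i : P).
  by apply/UI; apply: vbasis_mem; rewrite mem_nth ?size_tuple.
case: d U UI inU IU => [|e] U UI inU IU.
  pose w (A : 'M[K]_(r, n.+1)) (i : 'I_(\dim U)) : V 0 := (vbasis U)`_i.
  apply: (@generic_quotient K n r 0 _ w (fun i c => (coord (vbasis {:V 0}) c (vbasis U)`_i)%:MP)).
    by move=> A i c; rewrite mevalC.
  move=> A p; have hp := dhomog_is_dhomog p; rewrite (ideal_add_homog A homI hp).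
  split=> [[a [v [Ia ha v0 def_p]]]|[a def_p]].
    have [c def_a] := inU a ha Ia; exists c; apply: val_inj => /=.
    rewrite def_p def_a [X in _ + X]big1 ?addr0 ?linear_sum // => j _.
    by rewrite (eqP (v0 j)) mul0r.
  exists (p : P), (fun _ => 0); split=> //.
    rewrite def_p linear_sum; apply: ideal_sum => // i _ /=.
    by rewrite -mul_mpolyC; apply: (ideal_mull idI); exact: IU.
  by rewrite big1 ?addr0 // => j _; rewrite mul0r.
pose b := vbasis {:V e}; pose D := \dim {:V e}.
pose T : finType := ('I_(\dim U) + 'I_r * 'I_D)%type.
pose w (A : 'M[K]_(r, n.+1)) (t : T) : V e.+1 :=
  match t with
  | inl i => (vbasis U)`_i
  | inr (j, l) => \sum_k A j k *: xmul k b`_l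
  end.
pose F (t : T) c : {mpoly K[r * n.+1]} :=
  match t with
  | inl i => (coord (vbasis {:V e.+1}) c (vbasis U)`_i)%:MP
  | inr (j, l) => \sum_k coord (vbasis {:V e.+1}) c (xmul k b`_l) *: 'X_(mxvec_index j k)
  end.
have wE A j l : (w A (inr (j, l)) : P) = (b`_l : P) * lin_form A j.
  rewrite /w /lin_form linear_sum mulr_sumr; apply: eq_bigr => k _ /=.
  by rewrite -scalerAr mulrC.
apply: (@generic_quotient K n r e.+1 T w F) => [A [i|[j l]] c|A p] /=.
- by rewrite mevalC.
- rewrite !linear_sum; apply: eq_bigr => k _.
  by rewrite linearZ /= mevalZ mevalXU mxvecE mulrC.
have hp := dhomog_is_dhomog p; rewrite (ideal_add_homog A homI hp).
split=> [[a [v [Ia ha vh def_p]]]|[a def_p]].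
  have [c def_a] := inU a ha Ia.
  exists (fun t => match t with
    | inl i => c i
    | inr (j, l) => coord b l (DHomog (vh j) : V e) end).
  apply: val_inj => /=; rewrite def_p def_a linear_sum /= big_sumType /=.
  congr (_ + _).
  transitivity (\sum_j \sum_l coord b l (DHomog (vh j)) *: (w A (inr (j, l)) : P)); last first.
    by rewrite pair_big /=; apply: eq_bigr => -[j l] _.
  apply: eq_bigr => j _; have /coord_vbasis def_v : (DHomog (vh j) : V e) \in {:V e}%VS.
    exact: memvf.
  have def_vj : v j = \sum_l coord b l (DHomog (vh j)) *: (b`_l : P).
    by have := congr1 (@mpoly_of_dhomog _ _ _) def_v; rewrite linear_sum.
  rewrite [X in X * _]def_vj mulr_suml.
  by apply: eq_bigr => l _; rewrite wE scalerAl.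
exists (\sum_(i < \dim U) a (inl i) *: ((vbasis U)`_i : P)).
exists (fun j => \sum_(l < D) a (inr (j, l)) *: (b`_l : P)); split.
- apply: ideal_sum => // i _; rewrite -mul_mpolyC; apply: (ideal_mull idI); exact: IU.
- by apply: rpred_sum => i _; apply: rpredZ; exact: dhomog_is_dhomog.
- by move=> j; apply: rpred_sum => i _; apply: rpredZ; exact: dhomog_is_dhomog.
rewrite def_p linear_sum big_sumType /=; congr (_ + _).
transitivity (\sum_j \sum_l a (inr (j, l)) *: (w A (inr (j, l)) : P)).
  by rewrite pair_big /=; apply: eq_bigr => -[j l] _.
apply: eq_bigr => j _; rewrite mulr_suml; apply: eq_bigr => l _.
by rewrite wE scalerAl.
Qed.

Lemma sectional_matrixP I i d : homogeneous_ideal I ->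
  generically (fun A : 'M[K]_(n.+1 - i, n.+1) =>
    quotient_dim (ideal_add I (linear_forms_ideal A)) d (sectional_matrix I i d)).
Proof.
move=> homI; rewrite /sectional_matrix.
have := exists_generic_dim (n.+1 - i) d homI.
exact: ClassicalEpsilon.epsilon_spec.
Qed.

End SectionalMatrixSpec.

(** * Generic linear forms modulo a saturated ideal *)

Section ColonRadical.
Variables (R : comNzRingType) (I : R -> Prop) (a : R).
Hypothesis idI : is_ideal I.

(** The radical of the colon ideal [(I : a)]. *)
Definition colon_rad (p : R) : Prop := exists e, I (p ^+ e * a).

Lemma colon_rad_ideal : is_ideal colon_rad.
Proof.
split=> [|p q [e Ip] [f Iq]|c p [e Ip]].
- by exists 1%N; rewrite expr1 mul0r; exact: ideal_zero.
- exists (e + f)%N; rewrite exprDn mulr_suml; apply: ideal_sum => // i _.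
  rewrite mulrnAl -mulr_natl; apply: (ideal_mull idI).
  have [le_ei|lt_ie] := leqP f i.
    by rewrite -(subnK le_ei) exprD mulrA -[_ * q ^+ f * a]mulrA; exact: (ideal_mull idI).
  have le_e : (e <= e + f - i)%N by lia.
  rewrite -(subnK le_e) exprD.
  have -> (x : R) : x * p ^+ e * q ^+ i * a = x * q ^+ i * (p ^+ e * a) by ring.
  exact: (ideal_mull idI).
- by exists e; rewrite exprMn_comm ?mulrA -?mulrA; [exact: ideal_mull | exact: mulrC].
Qed.

Lemma colon_rad_incl p : I (p * a) -> colon_rad p.
Proof. by exists 1%N; rewrite expr1. Qed.

Lemma colon_rad_exp p e : colon_rad (p ^+ e) -> colon_rad p.
Proof. by move=> [f If]; exists (e * f)%N; rewrite exprM. Qed.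

End ColonRadical.

Section SaturatedRegular.
Variables (K : fieldType) (n : nat).
Hypothesis charK : [pchar K] =i pred0.
Local Notation P := {mpoly K[n.+1]}.
Local Notation V d := (dhomog n.+1 K d).
Variables (I : P -> Prop) (d : nat).
Hypotheses (idI : is_ideal I) (satI : saturated I).

(** Multiplying [a] by the last power of each variable that keeps it outside [I]
    would give an element outside [I] that every variable moves into [I]. *)
Lemma saturated_colon_rad a : (forall i : 'I_n.+1, colon_rad I a 'X_i) -> I a.
Proof.
move=> rad_a; apply: NNPP => nIa.
suff kill_upto j : (j <= n.+1)%N -> exists a', [/\ ~ I a',
    forall i : 'I_n.+1, (i < j)%N -> I (a' * 'X_i)
    & forall i : 'I_n.+1, colon_rad I a' 'X_i].
  have [a' [nIa' Xa' _]] := kill_upto n.+1 (leqnn _).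
  by apply: nIa'; apply: (proj1 (saturatedP idI) satI) => i; exact: Xa'.
elim: j => [|j IHj] lt_jn; first by exists a.
have [a' [nIa' Xa' rad_a']] := IHj (ltnW lt_jn); pose t := Ordinal lt_jn.
have [[|e] Ie min_e] := @least_nat (fun e => I ('X_t ^+ e * a')) (rad_a' t).
  by case: nIa'; rewrite -[a']mul1r -(expr0 'X_t).
exists ('X_t ^+ e * a'); split=> [Ie'|i lt_ij|i].
- by have := min_e e Ie'; rewrite ltnn.
- move: lt_ij; rewrite ltnS leq_eqVlt => /orP[/eqP eq_ij|lt_ij].
    have -> : i = t by exact: val_inj.
    by rewrite mulrC mulrA -exprS.
  by rewrite -mulrA; apply: (ideal_mull idI); exact: Xa'.
- by have [f If] := rad_a' i; exists f; rewrite mulrCA; exact: (ideal_mull idI).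
Qed.

Lemma dependent_tuple e (a : 'I_e -> V d) : (\dim {:V d} < e)%N ->
  exists (c : 'I_e -> K) (i0 : 'I_e), c i0 != 0 /\ \sum_i c i *: a i = 0.
Proof.
move=> lt_dim; pose X := [tuple a i | i < e].
have/negP nfree : ~~ free X.
  rewrite /free size_tuple; apply/negP => /eqP def_e.
  by have := dimvS (subvf <<X>>%VS); rewrite def_e leqNgt lt_dim.
apply: NNPP => no_c; apply: nfree; apply/freeP => c c0 i.
apply/eqP/negPn/negP => ci; apply: no_c; exists c, i; split=> //.
by rewrite -[RHS]c0; apply: eq_bigr => j _; rewrite -tnth_nth tnth_mktuple.
Qed.

Lemma prod_mod_ideal (R : comNzRingType) (J : R -> Prop) (T : Type) (s : seq T)
    (Q : pred T) (F G : T -> R) : is_ideal J ->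
  (forall i, Q i -> J (F i - G i)) ->
  J (\prod_(i <- s | Q i) F i - \prod_(i <- s | Q i) G i).
Proof.
move=> idJ JFG; elim/big_rec2: _ => [|i f g Qi Jfg].
  by rewrite subrr; exact: ideal_zero.
have -> : F i * g - G i * f = (F i - G i) * g + G i * (g - f) by ring.
by apply: (ideal_addr idJ); [apply: (ideal_mulr idJ); exact: JFG | exact: (ideal_mull idJ)].
Qed.

(** On a line of linear forms [L + t X_j] choose more points than the
    dimension of [P_d]; if all these forms kill some element of [P_d] modulo
    [I], these elements are dependent, so one of them is killed by the product
    of the other forms.  That element is killed by its own form as well, and up
    to the earlier variables, powers of which already kill it, the forms differ
    by nonzero multiples of [X_j]: hence it is killed by a power of [X_j].
    Repeating this for all variables contradicts saturation. *)
Lemma saturated_regular (E : lmodType K) (U : E -> Prop) (L : E -> P) (x : 'I_n.+1 -> E) :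
  (forall A t B, L (A + t *: B) = L A + t *: L B) -> (forall i, L (x i) = 'X_i) ->
  line_open U -> (exists A, U A) ->
  exists2 A, U A & forall g, g \is d.-homog -> I (L A * g) -> I g.
Proof.
move=> L_lin Lx openU [A0 UA0]; apply: NNPP => no_A.
have bad A : U A -> exists a : V d, ~ I a /\ I (L A * (a : P)).
  move=> UA; apply: NNPP => no_a; apply: no_A; exists A => // g hg Ig.
  by apply: NNPP => nIg; apply: no_a; exists (DHomog hg).
suff step j : (j <= n.+1)%N -> forall A, U A -> exists (A' : E) (a : V d),
    [/\ ~ I a, I (L A' * (a : P)),
      exists c : 'I_n.+1 -> K, L A' = L A + \sum_(i < n.+1 | (i < j)%N) c i *: 'X_i
      & forall i : 'I_n.+1, (i < j)%N -> colon_rad I a 'X_i].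
  have [A' [a [nIa _ _ rad_a]]] := step n.+1 (leqnn _) A0 UA0.
  by apply: nIa; apply: saturated_colon_rad => i; exact: rad_a.
elim: j => [|j IHj] lt_jn A UA.
  have [a [nIa Ia]] := bad A UA; exists A, a; split=> //.
  by exists (fun _ => 0); rewrite big_pred0 ?addr0.
pose t := Ordinal lt_jn; pose D := \dim {:V d}.
have [q q0 qP] := openU A (x t) UA.
have [ts [uniq_ts tsP]] := exists_nonroots charK D.+1 (horner0_neq0 q0).
have pick (i : 'I_D.+1) : exists y : E * V d * ('I_n.+1 -> K),
    [/\ ~ I y.1.2, I (L y.1.1 * (y.1.2 : P)),
      L y.1.1 = L A + tnth ts i *: 'X_t + \sum_(l < n.+1 | (l < j)%N) y.2 l *: 'X_l
      & forall l : 'I_n.+1, (l < j)%N -> colon_rad I y.1.2 'X_l].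
  have Ui : U (A + tnth ts i *: x t) by apply/qP/tsP/mem_tnth.
  have [A' [a [nIa Ia [c def_A'] rad_a]]] := IHj (ltnW lt_jn) _ Ui.
  by exists (A', a, c); split=> //=; rewrite def_A' L_lin Lx.
have [y yP] := ClassicalEpsilon.choice _ pick.
have [c [i0 [ci0 dep]]] := @dependent_tuple D.+1 (fun i => (y i).1.2) (ltnSn D).
have [nIa Ia def_L rad_a] := yP i0.
pose a : P := (y i0).1.2; pose rad := colon_rad I a.
have idrad : is_ideal rad := colon_rad_ideal a idI.
have dep' : \sum_i c i *: ((y i).1.2 : P) = 0.
  by have := congr1 (@mpoly_of_dhomog _ _ _) dep; rewrite linear_sum.
have def_a : a = - (c i0)^-1 *: \sum_(i | i != i0) c i *: ((y i).1.2 : P).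
  move: dep'; rewrite (bigD1 i0) //= => /eqP; rewrite addr_eq0 => /eqP dep'.
  by rewrite scaleNr -scalerN -dep' scalerA mulVf // scale1r.
have prod_a : rad (\prod_(i < D.+1 | i != i0) L (y i).1.1).
  apply: colon_rad_incl; rewrite def_a -scalerAr -mul_mpolyC; apply: (ideal_mull idI).
  rewrite mulr_sumr; apply: ideal_sum => // i ne_i.
  rewrite -scalerAr -mul_mpolyC; apply: (ideal_mull idI).
  rewrite (bigD1 i) //= mulrAC; apply: (ideal_mulr idI); by case: (yP i).
have prod_X : rad (\prod_(i < D.+1 | i != i0) ((tnth ts i - tnth ts i0) *: 'X_t)).
  rewrite -[X in rad X](subKr (\prod_(i < D.+1 | i != i0) L (y i).1.1)).
  apply: (ideal_subr idrad prod_a); apply: (prod_mod_ideal _ idrad) => i _.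
  have [_ _ def_Li _] := yP i.
  have rad_low (e : 'I_n.+1 -> K) : rad (\sum_(l < n.+1 | (l < j)%N) e l *: 'X_l).
    apply: (ideal_sum idrad) => l lt_lj; rewrite -mul_mpolyC; apply: (ideal_mull idrad).
    exact: rad_a.
  have -> : L (y i).1.1 - (tnth ts i - tnth ts i0) *: 'X_t =
      L (y i0).1.1 + (\sum_(l < n.+1 | (l < j)%N) (y i).2 l *: 'X_l
        - \sum_(l < n.+1 | (l < j)%N) (y i0).2 l *: 'X_l).
    rewrite def_Li def_L scalerBl; ring.
  apply: (ideal_addr idrad); first exact: colon_rad_incl Ia.
  exact: (ideal_subr idrad (rad_low _) (rad_low _)).
have rad_t : rad 'X_t.
  apply: (@colon_rad_exp _ I a _ #|[pred i : 'I_D.+1 | i != i0]|).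
  pose u := \prod_(i < D.+1 | i != i0) (tnth ts i - tnth ts i0).
  have u0 : u != 0.
    apply/prodf_neq0 => i ne_i; rewrite subr_eq0; apply: contra ne_i => /eqP.
    by move/(tuple_uniqP _ uniq_ts) ->.
  have def_prod : \prod_(i < D.+1 | i != i0) ((tnth ts i - tnth ts i0) *: 'X_t) =
      u *: 'X_t ^+ #|[pred i : 'I_D.+1 | i != i0]| :> P.
    by rewrite scaler_prod prodr_const.
  rewrite -[X in colon_rad _ _ X](scale1r) -(mulVf u0) -scalerA -def_prod.
  rewrite -mul_mpolyC; exact: (ideal_mull idrad).
exists (y i0).1.1, (y i0).1.2; split; [exact: nIa | exact: Ia | |].
  exists (fun l => if l == t then tnth ts i0 else (y i0).2 l).
  rewrite def_L -addrA; congr (_ + _); rewrite [RHS](bigD1 t) //= eqxx.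
  congr (_ + _).
  apply: eq_big => l; rewrite -?val_eqE /=; first by lia.
  by move=> lt_lj; rewrite ltn_eqF.
move=> l; rewrite ltnS leq_eqVlt => /orP[/eqP eq_lj|]; last exact: rad_a.
by have -> : l = t by exact: val_inj.
Qed.

End SaturatedRegular.

(** * Maximal growth and regular flags *)

Section Growth.
Variables (K : fieldType) (n : nat).
Local Notation P := {mpoly K[n.+1]}.
Local Notation V d := (dhomog n.+1 K d).

Fact codim_arith a1 a2 a3 w D D' e1 e2 e3 :
  (a1 + e1 = D -> a2 + e2 = D' -> a3 + e3 = D' -> a3 + w = a2 + D -> a1 <= w ->
  (e2 <= e1 + e3) /\ (e2 = e1 + e3 -> a1 = w))%N.
Proof. by clear; lia. Qed.

(** Multiplication by [L] is injective from [P_d] to [P_{d+1}], and [J'] is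
    [J] plus its image; so the defect in the dimension inequality is the
    dimension of the kernel of [L] on [P_d / J_d]. *)
Lemma growth_regular (J J' : P -> Prop) (L : P) d e1 e2 e3 :
  L \is 1.-homog -> L != 0 ->
  (forall g, g \is d.-homog -> J g -> J (L * g)) ->
  (forall p, p \is d.+1.-homog -> J' p <->
     exists a g, [/\ J a, a \is d.+1.-homog, g \is d.-homog & p = a + L * g]) ->
  quotient_dim J d e1 -> quotient_dim J d.+1 e2 -> quotient_dim J' d.+1 e3 ->
  (e2 <= e1 + e3)%N /\
  (e2 = (e1 + e3)%N -> forall g, g \is d.-homog -> J (L * g) -> J g).
Proof.
move=> hL L0 JL J'P /quotient_dim_vspace[U1 U1P dim1].
move=> /quotient_dim_vspace[U2 U2P dim2] /quotient_dim_vspace[U3 U3P dim3].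
pose lam (g : V d) : V d.+1 := DHomog (dhomogM hL (dhomog_is_dhomog g)).
have lam_lin : linear lam.
  move=> c p q; apply: val_inj => /=.
  by rewrite mulrDr scalerAr.
pose lamL : {linear V d -> V d.+1} := HB.pack lam
  (GRing.isLinear.Build K (V d) (V d.+1) _ lam lam_lin).
pose f := linfun lamL.
have fE (g : V d) : (f g : P) = L * (g : P) by rewrite lfunE.
have ker_f : lker f = 0%VS.
  apply/eqP; rewrite -subv0; apply/subvP => g; rewrite memv_ker memv0 => /eqP fg0.
  have := fE g; rewrite fg0 /= => /esym/eqP; rewrite mulf_eq0 (negbTE L0) /= => /eqP g0.
  by apply/eqP/val_inj.
pose W := (f @^-1: U2)%VS.
have WP (g : V d) : g \in W <-> J (L * (g : P)).
  by rewrite -memv_preim -fE; exact: U2P.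
have sub_UW : (U1 <= W)%VS.
  by apply/subvP => g /U1P Jg; apply/WP; apply: JL Jg; exact: dhomog_is_dhomog.
have def_U3 : U3 = (U2 + limg f)%VS.
  apply/vspaceP => p; apply/idP/idP.
    move/U3P/(J'P p (dhomog_is_dhomog p)) => [a [g [Ja ha hg def_p]]].
    have -> : p = DHomog ha + f (DHomog hg) by apply: val_inj; rewrite /= fE.
    by apply: memv_add; [apply/U2P | rewrite memv_img ?memvf].
  case/memv_addP => a U2a [_ /memv_imgP[g _ ->] ->]; apply/U3P.
  apply/(J'P _ (dhomog_is_dhomog _)); exists a, g; rewrite -fE.
  by split=> //; [apply/U2P | exact: dhomog_is_dhomog | exact: dhomog_is_dhomog].
have dim_img U : \dim (f @: U) = \dim U by rewrite limg_dim_eq // ker_f capv0.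
have dimW : \dim W = \dim (U2 :&: limg f)%VS.
  by rewrite -(dim_img W) /W -lpreim_cap_limg lpreimK // capvSr.
have := dimv_sum_cap U2 (limg f); rewrite -def_U3 -dimW dim_img => dim_sum.
have [le_e eq_dim] := codim_arith dim1 dim2 dim3 dim_sum (dimvS sub_UW).
split=> // /eq_dim eq_dimW g hg JLg; apply/(U1P (DHomog hg)).
suff -> : U1 = W by apply/WP.
by apply/eqP; rewrite -(dimv_leqif_eq sub_UW); apply/eqP.
Qed.

(** The inequalities add up to [y e <= x 1 + ... + x e], so that equality there
    forces equality in each of them. *)
Lemma tight_growth (x y : nat -> nat) e :
  (forall j, (j < e)%N -> (y j.+1 <= x j.+1 + y j)%N) -> y 0 = 0%N ->
  y e = (\sum_(1 <= j < e.+1) x j)%N ->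
  forall j, (j < e)%N -> y j.+1 = (x j.+1 + y j)%N.
Proof.
move=> le_y y0; have le_sum l : (l <= e)%N -> (y l <= \sum_(1 <= j < l.+1) x j)%N.
  elim: l => [|l IHl] lt_le; first by rewrite y0.
  rewrite big_nat_recr //= addnC; apply: leq_trans (le_y l lt_le) _.
  by rewrite leq_add2l IHl // ltnW.
elim: e le_y le_sum => // e IHe le_y le_sum def_y j; rewrite ltnS.
have le_ye := le_sum e (leqnSn e); have le_ye1 := le_y e (ltnSn e).
rewrite big_nat_recr //= in def_y.
rewrite leq_eqVlt => /orP[/eqP->|lt_je]; first by lia.
apply: IHe lt_je => [l lt_le|l le_le|].
- by apply: le_y; exact: leqW.
- by apply: le_sum; exact: leqW.
- by apply/eqP; lia.
Qed.

End Growth.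

Section Flag.
Variables (K : fieldType) (n : nat).
Hypothesis charK : [pchar K] =i pred0.
Local Notation N := n.+1.
Local Notation P := {mpoly K[n.+1]}.
Local Notation V d := (dhomog n.+1 K d).
Variables (I : P -> Prop).
Hypothesis (homI : homogeneous_ideal I) (satI : saturated I).
Let idI : is_ideal I := proj1 homI.
Implicit Types A : 'M[K]_N.

Definition top_rows i A : 'M[K]_(N - i, N) := rowsub (widen_ord (leq_subr i N)) A.

(** Membership in [I + (L_0, ..., L_{r-1})] for the rows [L_s] of [A]. *)
Definition flag_mod A r (p : P) : Prop := exists2 a, I a
  & exists v : 'I_N -> P, p = a + \sum_(s < N | (s < r)%N) lin_form A s * v s.

Lemma flag_modP A i p :
  ideal_add I (linear_forms_ideal (top_rows i A)) p <-> flag_mod A (N - i) p.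
Proof.
have top_form j : lin_form (top_rows i A) j = lin_form A (widen_ord (leq_subr i N) j).
  by apply: eq_bigr => k _; rewrite mxE.
split=> [[a [l [Ia Ll ->]]]|[a Ia [v ->]]].
  exists a => //; suff [v ->] : exists v : 'I_N -> P,
    l = \sum_(s < N | (s < N - i)%N) lin_form A s * v s by exists v.
  move: l Ll; apply: ideal_gen_sub => [|_ [j ->]].
    split=> [|_ _ [v ->] [w ->]|q _ [v ->]].
    - by exists (fun _ => 0); rewrite big1 // => s _; rewrite mulr0.
    - by exists (fun s => v s + w s); rewrite -big_split; apply: eq_bigr => s _; rewrite mulrDr.
    - exists (fun s => q * v s); rewrite mulr_sumr; apply: eq_bigr => s _.
      by rewrite mulrCA.
  exists (fun s => (s == widen_ord (leq_subr i N) j)%:R).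
  rewrite -/(lin_form _ _) top_form (bigD1 (widen_ord (leq_subr i N) j)) //=.
  rewrite eqxx mulr1 big1 ?addr0 // => s /andP[_ /negbTE->]; exact: mulr0.
exists a, (\sum_(s < N | (s < N - i)%N) lin_form A s * v s); split=> //.
apply: (ideal_sum (linear_forms_is_ideal _)) => s lt_s.
apply: (ideal_mulr (linear_forms_is_ideal _)); apply: ideal_gen_incl.
exists (Ordinal lt_s); rewrite -/(lin_form _ _) top_form; congr lin_form.
exact: val_inj.
Qed.

Lemma flag_mod_succ A (t : 'I_N) p :
  flag_mod A t.+1 p <-> exists2 a, flag_mod A t a & exists g, p = a + lin_form A t * g.
Proof.
split=> [[a Ia [v ->]]|[_ [a Ia [v ->]] [g ->]]].
  exists (a + \sum_(s < N | (s < t)%N) lin_form A s * v s); first by exists a => //; exists v.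
  exists (v t); rewrite -addrA; congr (_ + _); rewrite (bigD1 t) //= addrC; congr (_ + _).
  by apply: eq_bigl => s; rewrite -val_eqE /=; lia.
exists a => //; exists (fun s => if s == t then g else v s); rewrite -addrA; congr (_ + _).
rewrite [RHS](bigD1 t) //= eqxx addrC; congr (_ + _).
apply: eq_big => s; rewrite -val_eqE /=; first by lia.
by move=> lt_st; rewrite ltn_eqF.
Qed.

Lemma flag_mod_homog A r d p : flag_mod A r p -> flag_mod A r (pihomog mdeg d p).
Proof.
move=> [a Ia [v ->]]; exists (pihomog mdeg d a); first exact: (proj2 homI).
exists (fun s => if d is e.+1 then pihomog mdeg e (v s) else 0).
rewrite linearD linear_sum; congr (_ + _); apply: eq_bigr => s _ /=.
rewrite mulrC; case: d => [|e].
  by rewrite (pihomogM_lt _ (homog_lin_form A s)) ?mulr0.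
by rewrite -[e.+1]addn1 (pihomogM _ _ (homog_lin_form A s)) mulrC.
Qed.

Lemma flag_mod_mull A r q p : flag_mod A r p -> flag_mod A r (q * p).
Proof.
move=> [a Ia [v ->]]; exists (q * a); first exact: ideal_mull.
exists (fun s => q * v s); rewrite mulrDr mulr_sumr; congr (_ + _).
by apply: eq_bigr => s _; rewrite mulrCA.
Qed.

Lemma lin_form_neq0 A s : A \in unitmx -> lin_form A s != 0.
Proof.
move=> unitA; apply/eqP => As0.
have As (j : 'I_N) : A s j = 0.
  have := congr1 (mcoeff U_(j)) As0; rewrite mcoeff0 linear_sum /= => <-.
  rewrite (bigD1 j) //= mcoeffZ mcoeffX eqxx mulr1 big1 ?addr0 // => k ne_kj.
  by rewrite mcoeffZ mcoeffX eq_mnm1 (negbTE ne_kj) mulr0.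
have /matrixP/(_ s s) := mulmxV unitA; rewrite !mxE eqxx big1 => [|j _].
  by move/eqP; rewrite eq_sym oner_eq0.
by rewrite As mul0r.
Qed.

Lemma lin_form_span A (k : 'I_N) : A \in unitmx ->
  'X_k = \sum_s lin_form A s * (invmx A k s)%:MP.
Proof.
move=> unitA; under eq_bigr => s _.
  rewrite mulrC mul_mpolyC scaler_sumr; under eq_bigr => j _ do rewrite scalerA.
  over.
rewrite exchange_big /= (bigD1 k) //= -scaler_suml.
have inv_k j : \sum_s invmx A k s * A s j = (k == j)%:R.
  by have /matrixP/(_ k j) := mulVmx unitA; rewrite !mxE.
rewrite inv_k eqxx scale1r big1 ?addr0 // => j ne_jk.
by rewrite -scaler_suml inv_k eq_sym (negbTE ne_jk) scale0r.
Qed.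

Lemma flag_mod_full A d p : A \in unitmx -> p \is d.+1.-homog -> flag_mod A N p.
Proof.
move=> unitA hp; exists 0; first exact: ideal_zero.
have [u ->] : exists u : 'I_N -> P, p = \sum_k 'X_k * u k.
  rewrite -(pihomog_dE hp); elim/mpolyind: p {hp} => [|c m p _ _ [u def_p]].
    by exists (fun _ => 0); rewrite linear0 big1 // => k _; rewrite mulr0.
  rewrite linearD linearZ /= pihomogX def_p; case: eqP => [def_d|_]; last first.
    by exists u; rewrite scaler0 add0r.
  have : mdeg m != 0%N by rewrite def_d.
  rewrite mdegE sum_nat_eq0 negb_forall => /existsP[t /= mt0].
  exists (fun k => u k + (c *: 'X_[m - U_(t)]) *+ (k == t)).
  under [RHS]eq_bigr do rewrite mulrDr; rewrite big_split addrC; congr (_ + _).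
  rewrite (bigD1 t) //= eqxx mulr1n big1 ?addr0 => [|k /negbTE->]; last by rewrite mulr0n mulr0.
  by rewrite -scalerAr -mpolyXD addmC submK // lep1mP.
exists (fun s => \sum_k (invmx A k s)%:MP * u k); rewrite add0r.
under [RHS]eq_bigr do rewrite mulr_sumr.
rewrite [RHS](eq_bigl predT) => [|s]; last by rewrite ltn_ord.
rewrite exchange_big /=; apply: eq_bigr => k _.
by rewrite [in LHS](lin_form_span k unitA) mulr_suml; apply: eq_bigr => s _; rewrite mulrA.
Qed.

Lemma quotient_dim0 (J : P -> Prop) d :
  (forall p, p \is d.-homog -> J p) -> quotient_dim J d 0.
Proof.
move=> Jall; exists (\0 : {linear V d -> 'rV[K]_0}) => [v|p].
  by exists 0; apply/rowP => -[].
by split=> _; [apply: Jall; exact: dhomog_is_dhomog | apply/rowP => -[]].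
Qed.

(** For generic coordinates maximal growth makes each row of [A] a
    nonzerodivisor in degree [d] modulo [I] and the earlier rows.  The first
    row is not covered by the growth hypothesis but by saturation. *)
Lemma exists_regular_flag d : maximal_growth I n d ->
  exists A, [/\ A \in unitmx,
    forall (t : 'I_N) g, g \is d.-homog ->
      flag_mod A t (lin_form A t * g) -> flag_mod A t g
  & forall i, (0 < i <= N)%N ->
      quotient_dim (flag_mod A (N - i)) d (sectional_matrix I i d)].
Proof.
move=> growth.
pose good (id : nat * nat) A :=
  quotient_dim (flag_mod A (N - id.1)) id.2 (sectional_matrix I id.1 id.2).
have [U openU [[A0 UA0] Ugood]] : exists2 U : 'M[K]_N -> Prop, line_open U &
    (exists A, U A) /\ forall A, U A -> A \in unitmx /\
      forall i e, (i <= N)%N -> (e \in [:: d; d.+1]) -> good (i, e) A.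
  pose dense (id : nat * nat) (W : 'M[K]_(N - id.1, N) -> Prop) := [/\ zariski_open W,
    exists B, W B & forall B, W B ->
      quotient_dim (ideal_add I (linear_forms_ideal B)) id.2 (sectional_matrix I id.1 id.2)].
  have exW id : exists W, dense id W by case: id => i e; exact: sectional_matrixP.
  pose W id := ClassicalEpsilon.epsilon (inhabits (fun _ => True)) (dense id).
  have WP id : dense id (W id) by exact: ClassicalEpsilon.epsilon_spec (exW id).
  pose s := [seq (i, e) | i <- iota 0 N.+1, e <- [:: d; d.+1]].
  pose T (id : nat * nat) A := W id (top_rows id.1 A).
  have top_lin i A t B : top_rows i (A + t *: B) = top_rows i A + t *: top_rows i B.
    by apply/matrixP => j k; rewrite !mxE.
  have [openT exT] : line_open (fun A => forall id, id \in s -> T id A) /\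
      exists A, forall id, id \in s -> T id A.
    apply: (line_open_all charK) => -[i e] _; have [openW [B WB] _] := WP (i, e).
    split; first exact: (line_open_preim (@top_lin i) (zariski_line_open openW)).
    (* any point of the smaller matrix space, padded with zero rows *)
    exists (\matrix_(j, k) if insub (j : nat) is Some j' then B j' k else 0).
    suff -> : T (i, e) (\matrix_(j, k) if insub (j : nat) is Some j' then B j' k else 0) = W (i, e) B by [].
    congr (W (i, e)); apply/matrixP => j k; rewrite !mxE /=.
    by rewrite (insubT (fun l => l < N - i)%N (ltn_ord j)) /=; congr (B _ k); exact: val_inj.
  exists (fun A => (A \in unitmx) /\ forall id, id \in s -> T id A).
    exact: line_open_meet (@unitmx_line_open K N) openT.
  split.
    apply: (line_open_nonempty_meet charK (@unitmx_line_open K N) openT) => //.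
    by exists 1%:M; exact: unitmx1.
  move=> A [unitA TA]; split=> // i e le_iN e_d.
  have [_ _ /(_ (top_rows i A))] := WP (i, e).
  move/(_ (TA (i, e) _)); rewrite allpairs_f ?mem_iota //= => /(_ isT).
  by apply: quotient_dim_eq => p _; exact: flag_modP.
have [|i|||A UA regA] := @saturated_regular K n charK I d idI satI _ U
    (fun A => lin_form A ord0) (fun k => delta_mx ord0 k).
- move=> A t B; rewrite scaler_sumr -big_split; apply: eq_bigr => k _ /=.
  by rewrite !mxE scalerDl scalerA.
- rewrite /lin_form (bigD1 i) //= mxE !eqxx scale1r big1 ?addr0 // => k ne_ki.
  by rewrite mxE (negbTE ne_ki) andbF scale0r.
- exact: openU.
- by exists A0.
have [unitA goodA] := Ugood A UA.
have goodA0 i : (i <= N)%N -> quotient_dim (flag_mod A (N - i)) d (sectional_matrix I i d).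
  by move=> le_iN; apply: (goodA i d le_iN); rewrite mem_head.
have goodA1 i : (i <= N)%N -> quotient_dim (flag_mod A (N - i)) d.+1 (sectional_matrix I i d.+1).
  by move=> le_iN; apply: (goodA i d.+1 le_iN); rewrite !inE eqxx orbT.
exists A; split=> //; last by move=> i /andP[_]; exact: goodA0.
pose x i := sectional_matrix I i d.
(* all n + 1 forms together generate everything in positive degree, which
   starts the chain of inequalities at 0 *)
pose y i := if i is 0 then 0%N else sectional_matrix I i d.+1.
have goody i : (i <= N)%N -> quotient_dim (flag_mod A (N - i)) d.+1 (y i).
  case: i => [_|i]; last exact: goodA1.
  by apply: quotient_dim0 => p; rewrite subn0; exact: flag_mod_full.
have step (t : 'I_N) i : (N - i.+1 = t)%N -> (i < N)%N ->
    (y i.+1 <= x i.+1 + y i)%N /\ (y i.+1 = (x i.+1 + y i)%N ->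
     forall g, g \is d.-homog -> flag_mod A t (lin_form A t * g) -> flag_mod A t g).
  move=> def_t lt_iN; apply: (@growth_regular K n (flag_mod A t) (flag_mod A t.+1)).
  - exact: homog_lin_form.
  - exact: lin_form_neq0.
  - by move=> g _; exact: flag_mod_mull.
  - move=> p hp; rewrite flag_mod_succ; split=> [[a fa [g def_p]]|[a [g [fa _ _ ->]]]]; last first.
      by exists a => //; exists g.
    exists (pihomog mdeg d.+1 a), (pihomog mdeg d g).
    split; [exact: flag_mod_homog | exact: pihomogP | exact: pihomogP |].
    rewrite -(pihomog_dE hp) def_p linearD /=; congr (_ + _).
    by rewrite [lin_form A t * g]mulrC -[d.+1]addn1 (pihomogM _ _ (homog_lin_form A t)) mulrC.
  - by rewrite -def_t; exact: goodA0.
  - by rewrite -def_t; exact: goody.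
  - by rewrite (_ : t.+1 = N - i)%N; [apply: goody; exact: ltnW | rewrite -def_t subnSK].
move=> t g hg; have [t0|t_gt0] := posnP t.
  have -> : t = ord0 by exact: val_inj.
  have flag0 p : flag_mod A 0 p <-> I p.
    split=> [[a Ia [v ->]]|Ip]; first by rewrite big_pred0 ?addr0.
    by exists p => //; exists (fun _ => 0); rewrite big_pred0 ?addr0.
  by move/flag0/(regA g hg) => Ig; apply/flag0.
pose i := (N - t.+1)%N.
have lt_iN : (i < N)%N by rewrite /i; have := ltn_ord t; lia.
have def_t : (N - i.+1)%N = t by rewrite /i; have := ltn_ord t; lia.
have lt_in : (i < n)%N by rewrite /i; have := ltn_ord t; lia.
apply: (proj2 (step t i def_t lt_iN)) => //.
apply: (@tight_growth x y n) => // [j lt_jn|].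
  have lt_jN : (j < N)%N by exact: leqW.
  have lt_N : (N - j.+1 < N)%N by lia.
  by have [] := step (Ordinal lt_N) j erefl lt_jN.
have yE l : (0 < l)%N -> y l = sectional_matrix I l d.+1 by case: l.
by rewrite yE //; exact: leq_ltn_trans lt_in.
Qed.

End Flag.

(** * Linear changes of coordinates *)

HB.lock Definition lin_subst (K : fieldType) n (A : 'M[K]_n.+1) (p : {mpoly K[n.+1]}) :=
  p \mPo [tuple lin_form A i | i < n.+1].

Section LinSubst.
Variables (K : fieldType) (n : nat).
Local Notation P := {mpoly K[n.+1]}.
Implicit Types (p q : P) (A B : 'M[K]_n.+1).

Lemma lin_substC A c : lin_subst A c%:MP = c%:MP.
Proof. by rewrite lin_subst.unlock comp_mpolyC. Qed.

Lemma lin_substX A i : lin_subst A 'X_i = lin_form A i.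
Proof. by rewrite lin_subst.unlock comp_mpolyXU -tnth_nth tnth_mktuple. Qed.

Lemma lin_substD A : {morph lin_subst A : p q / p + q}.
Proof. by move=> p q; rewrite lin_subst.unlock comp_mpolyD. Qed.

Lemma lin_substM A : {morph lin_subst A : p q / p * q}.
Proof. by move=> p q; rewrite lin_subst.unlock rmorphM. Qed.

Lemma lin_subst0 A : lin_subst A 0 = 0.
Proof. by rewrite lin_subst.unlock comp_mpoly0. Qed.

Lemma lin_substZ A c p : lin_subst A (c *: p) = c *: lin_subst A p.
Proof. by rewrite lin_subst.unlock comp_mpolyZ. Qed.

Lemma lin_subst_sum A (T : Type) (s : seq T) (Q : pred T) (F : T -> P) :
  lin_subst A (\sum_(i <- s | Q i) F i) = \sum_(i <- s | Q i) lin_subst A (F i).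
Proof. exact: (big_morph _ (lin_substD A) (lin_subst0 A)). Qed.

Lemma lin_subst_form A B i : lin_subst A (lin_form B i) = lin_form (B *m A) i.
Proof.
rewrite lin_subst_sum /lin_form; under eq_bigr => k _.
  rewrite lin_substZ lin_substX scaler_sumr; under eq_bigr => j _ do rewrite scalerA.
  over.
rewrite exchange_big; apply: eq_bigr => j _ /=.
by rewrite -scaler_suml; congr (_ *: _); rewrite mxE.
Qed.

Lemma lin_subst_comp A B p : lin_subst A (lin_subst B p) = lin_subst (B *m A) p.
Proof.
elim/mpoly_gen_ind: p => [c|i|p q IHp IHq|p q IHp IHq].
- by rewrite !lin_substC.
- by rewrite !lin_substX lin_subst_form.
- by rewrite !lin_substD IHp IHq.
- by rewrite !lin_substM IHp IHq.
Qed.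

Lemma lin_subst1 p : lin_subst 1%:M p = p.
Proof.
elim/mpoly_gen_ind: p => [c|i|p q IHp IHq|p q IHp IHq].
- by rewrite lin_substC.
- rewrite lin_substX /lin_form (bigD1 i) //= mxE eqxx scale1r big1 ?addr0 // => k ne_ki.
  by rewrite mxE eq_sym (negbTE ne_ki) scale0r.
- by rewrite lin_substD IHp IHq.
- by rewrite lin_substM IHp IHq.
Qed.

Lemma homog_lin_substX A m : lin_subst A 'X_[m] \is (mdeg m).-homog.
Proof.
rewrite mpolyXE_id mdegE lin_subst.unlock rmorph_prod /=.
elim/big_rec2: _ => [|i p d _ hp]; first exact: dhomog1.
rewrite dhomogM // rmorphXn /=; have := dhomogMn (m i) (homog_lin_form A i).
by rewrite mul1n comp_mpolyXU -tnth_nth tnth_mktuple.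
Qed.

Lemma pihomog_lin_subst A d p :
  pihomog mdeg d (lin_subst A p) = lin_subst A (pihomog mdeg d p).
Proof.
elim/mpolyind: p => [|c m p _ _ IHp]; first by rewrite !(lin_subst0, linear0).
rewrite lin_substD !linearD /= lin_substD IHp; congr (_ + _).
rewrite lin_substZ !linearZ /= lin_substZ pihomogX; congr (_ *: _).
case: eqP => [<-|/eqP ne_d]; first by rewrite pihomog_dE ?homog_lin_substX.
by rewrite (pihomog_ne0 ne_d (homog_lin_substX A m)) lin_subst0.
Qed.

Lemma homog_lin_subst A d p : p \is d.-homog -> lin_subst A p \is d.-homog.
Proof. by move=> hp; rewrite -(pihomog_dE hp) -pihomog_lin_subst pihomogP. Qed.

Lemma msize_lin_subst_leq A p : (msize (lin_subst A p) <= msize p)%N.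
Proof.
rewrite [X in (X <= _)%N]msizeE; apply/bigmax_leqP_seq => m m_Ap _.
have pm_neq0 : pihomog mdeg (mdeg m) p != 0.
  apply: contraTneq m_Ap => pm0; rewrite mcoeff_msupp negbK; apply/eqP.
  have := congr1 (mcoeff m) (pihomog_lin_subst A (mdeg m) p).
  by rewrite pm0 lin_subst0 mcoeff0 mcoeff_pihomog eqxx mulr1n.
have := mlead_supp pm_neq0; rewrite mcoeff_msupp mcoeff_pihomog.
case: (eqVneq _ (mdeg m)) => [eq_deg|_]; last by rewrite eqxx.
by rewrite mulr1n -mcoeff_msupp => /msize_mdeg_lt; rewrite eq_deg.
Qed.

Section Invertible.
Variable A : 'M[K]_n.+1.
Hypothesis unitA : A \in unitmx.

Lemma lin_substK : cancel (lin_subst (invmx A)) (lin_subst A).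
Proof. by move=> p; rewrite lin_subst_comp mulVmx // lin_subst1. Qed.

Lemma lin_substVK : cancel (lin_subst A) (lin_subst (invmx A)).
Proof. by move=> p; rewrite lin_subst_comp mulmxV // lin_subst1. Qed.

Lemma msize_lin_subst p : msize (lin_subst A p) = msize p.
Proof.
apply/eqP; rewrite eqn_leq msize_lin_subst_leq /=.
by have := msize_lin_subst_leq (invmx A) (lin_subst A p); rewrite lin_substVK.
Qed.

Variable I : P -> Prop.
Hypotheses (homI : homogeneous_ideal I).
Let idI : is_ideal I := proj1 homI.
Local Notation IA := (fun p : P => I (lin_subst A p)).

Lemma lin_subst_homogeneous : homogeneous_ideal IA.
Proof.
split=> [|p d Ip]; last by rewrite -pihomog_lin_subst; exact: (proj2 homI).
split=> [|p q Ip Iq|p q Iq].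
- by rewrite lin_subst0; exact: ideal_zero.
- by rewrite lin_substD; exact: ideal_addr.
- by rewrite lin_substM; exact: ideal_mull.
Qed.

Lemma lin_subst_saturated : saturated I -> saturated IA.
Proof.
move=> satI; apply/(saturatedP (proj1 lin_subst_homogeneous)) => p IpX.
apply: (proj1 (saturatedP idI) satI) => k; rewrite (lin_form_span k unitA) mulr_sumr.
apply: ideal_sum => // s _; rewrite mulrA; apply: ideal_mulr => //.
by have := IpX s; rewrite lin_substM lin_substX.
Qed.

Lemma truncation_lin_subst b p :
  truncation_ideal IA b p <-> truncation_ideal I b (lin_subst A p).
Proof.
split.
  move: p; apply: ideal_gen_sub => [|q [Iq [d le_db hq]]].
    split=> [|p q Ip Iq|p q Iq].
    - by rewrite lin_subst0; exact: ideal_zero (ideal_gen_ideal _).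
    - by rewrite lin_substD; exact: (ideal_addr (ideal_gen_ideal _)).
    - by rewrite lin_substM; exact: (ideal_mull (ideal_gen_ideal _)).
  by apply: truncation_incl le_db Iq _; exact: homog_lin_subst.
move=> [s sI def_p]; exists [seq (lin_subst (invmx A) u.1, lin_subst (invmx A) u.2) | u <- s].
  move=> _ /mapP[v /sI[Iv [d le_db hv]] ->] /=; split; first by rewrite lin_substK.
  by exists d => //; exact: homog_lin_subst.
rewrite -[p]lin_substVK def_p lin_subst_sum big_map; apply: eq_bigr => u _.
exact: lin_substM.
Qed.

Lemma in_mod_lin_subst r p : (r <= n.+1)%N ->
  in_mod IA r p <-> flag_mod I A r (lin_subst A p).
Proof.
move=> le_rn; split=> [[a Ia eq_ap]|[a Ia [v def_p]]].
  exists (lin_subst A a) => //.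
  have [v def_v] : exists v : 'I_n.+1 -> P, p - a = \sum_(s < n.+1 | (s < r)%N) 'X_s * v s.
    have : kill r (p - a) = 0 by rewrite killB eq_ap subrr.
    elim: r {eq_ap} le_rn (p - a) => [|r IHr] lt_rn q q0.
      by exists (fun _ => 0); rewrite -[q]kill_none q0 big_pred0.
    pose t := Ordinal lt_rn; have [u def_q] := kill_step t q.
    have [|v def_v] := IHr (ltnW lt_rn) (q - 'X_t * u).
      have t0 : kill r ('X_t * u) = kill r q.
        by rewrite q0 addr0 in def_q; rewrite -def_q kill_kill.
      by rewrite killB t0 subrr.
    exists (fun s => if s == t then u else v s).
    rewrite (bigD1 t) //= eqxx -[LHS](subrK ('X_t * u)) def_v addrC; congr (_ + _).
    apply: eq_big => s; rewrite -val_eqE /=; first by lia.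
    by move=> lt_sr; rewrite ltn_eqF.
  exists (fun s => lin_subst A (v s)); rewrite -[p](subrK a) def_v addrC lin_substD.
  rewrite lin_subst_sum; congr (_ + _); apply: eq_bigr => s _.
  by rewrite lin_substM lin_substX.
exists (lin_subst (invmx A) a); first by rewrite lin_substK.
have -> : p = lin_subst (invmx A) a
    + \sum_(s < n.+1 | (s < r)%N) 'X_s * lin_subst (invmx A) (v s).
  apply: (can_inj lin_substVK); rewrite def_p lin_substD lin_substK; congr (_ + _).
  rewrite lin_subst_sum; apply: eq_bigr => s _.
  by rewrite lin_substM lin_substX lin_substK.
rewrite killD kill_sum big1 ?addr0 // => s lt_sr.
by rewrite killM killX lt_sr mul0r.
Qed.

Lemma quotient_dim_lin_subst (J : P -> Prop) d e :
  quotient_dim J d e -> quotient_dim (fun p => J (lin_subst A p)) d e.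
Proof.
move=> [f f_surj f_ker].
pose g (p : dhomog n.+1 K d) : dhomog n.+1 K d :=
  DHomog (homog_lin_subst A (dhomog_is_dhomog p)).
have g_lin : linear g by move=> c p q; apply: val_inj; rewrite /= lin_substD lin_substZ.
pose gL : {linear dhomog n.+1 K d -> dhomog n.+1 K d} := HB.pack g
  (GRing.isLinear.Build K (dhomog n.+1 K d) (dhomog n.+1 K d) _ g g_lin).
pose h : {linear dhomog n.+1 K d -> 'rV[K]_e} := f \o gL.
exists h => [v|p]; last exact: f_ker.
have [p <-] := f_surj v.
exists (DHomog (homog_lin_subst (invmx A) (dhomog_is_dhomog p))).
rewrite /h /=; congr (f _); apply: val_inj; exact: lin_substK.
Qed.

Lemma lin_subst_gcd (J : P -> Prop) g :
  is_gcd (fun p => J (lin_subst A p)) g -> is_gcd J (lin_subst A g).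
Proof.
move=> [g_div g_max]; split=> [p Jp|h h_div].
  have [|q def_q] := g_div (lin_subst (invmx A) p); first by rewrite lin_substK.
  by exists (lin_subst A q); rewrite -lin_substM -def_q lin_substK.
have [|q def_q] := g_max (lin_subst (invmx A) h).
  move=> p /h_div[q def_q]; exists (lin_subst (invmx A) q).
  by rewrite -lin_substM -def_q lin_substVK.
by exists (lin_subst A q); rewrite def_q lin_substM lin_substK.
Qed.

End Invertible.

End LinSubst.

(** * Ideals with maximal growth *)

Theorem corollary7p7 (K : fieldType) (charK : [pchar K] =i pred0)
  (n : nat) (hn : (2 <= n)%N)
  (I : {mpoly K[n]} -> Prop) (homI : homogeneous_ideal I) (satI : saturated I)
  (delta : nat)
  (Idelta : exists p, [/\ I p, p \is delta.-homog & p != 0])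
  (growth : maximal_growth I n.-1 delta)
  (k : nat) (hk : k = sectional_matrix I 2 delta) (k_ge1 : (1 <= k)%N) :
  [/\ (forall p, truncation_ideal I delta p <-> truncation_ideal I delta.+1 p),
      saturated (truncation_ideal I delta)
    & exists2 g, is_gcd (truncation_ideal I delta) g & msize g = k.+1].
Proof.
case: n hn I homI satI Idelta growth hk => [//|[//|m]] _ I homI satI [f [If hf f0]].
rewrite /= => growth hk.
have [A [unitA regA dimA]] := exists_regular_flag charK homI satI growth.
pose IA p := I (lin_subst A p).
have homIA : homogeneous_ideal IA := lin_subst_homogeneous A homI.
have satIA : saturated IA := lin_subst_saturated unitA homI satI.
have regIA (t : 'I_m.+2) : regular_at IA delta t.
  move=> g hg; have le_tn := ltnW (ltn_ord t).
  move/(in_mod_lin_subst unitA I _ le_tn); rewrite lin_substM lin_substX => in_t.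
  apply/(in_mod_lin_subst unitA I _ le_tn).
  by apply: regA in_t; exact: homog_lin_subst.
have stable := truncation_stable homIA regIA.
have saturatedT := truncation_saturated homIA satIA regIA.
pose N := truncation_ideal IA delta.
have NE p : N p <-> truncation_ideal I delta (lin_subst A p).
  exact: truncation_lin_subst.
have dimN : quotient_dim (in_mod N m) delta k.
  have := quotient_dim_lin_subst unitA (dimA 2 isT); rewrite -hk subn2 /=.
  apply: quotient_dim_eq => p hp.
  apply: iff_trans (iff_sym (in_mod_lin_subst unitA I p (leqW (leqnSn m)))) _.
  split=> [/(in_mod_homog homIA hp)[a [Ia ha eq_ap]]|[a Na eq_ap]]; exists a => //.
    exact: truncation_incl ha.
  exact: truncation_sub Na.
split.
- have NVE b p : truncation_ideal IA b (lin_subst (invmx A) p) <-> truncation_ideal I b p.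
    by rewrite -{2}[p](lin_substK unitA); exact: truncation_lin_subst.
  by move=> p; exact: iff_trans (iff_sym (NVE _ _)) (iff_trans (stable _) (NVE _ _)).
- apply/(saturatedP (truncation_is_ideal I delta)) => p pX.
  rewrite -[p](lin_substK unitA); apply/NE.
  apply: (proj1 (saturatedP (truncation_is_ideal IA delta)) saturatedT) => i.
  apply/NE; rewrite lin_substM lin_substK // lin_substX mulr_sumr.
  apply: (ideal_sum (truncation_is_ideal I delta)) => j _.
  rewrite -scalerAr -mul_mpolyC; exact: (ideal_mull (truncation_is_ideal I delta)).
- have Nf : N (lin_subst (invmx A) f).
    by apply/NE; rewrite lin_substK //; exact: truncation_incl hf.
  have f'0 : lin_subst (invmx A) f != 0.
    by apply: contra_neq f0 => e0; rewrite -[f](lin_substK unitA) e0 lin_subst0.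
  have [g g_gcd szg] := exists_gcd (truncation_homogeneous IA delta)
    (truncation_regular homIA regIA) dimN Nf (homog_lin_subst _ hf) f'0.
  exists (lin_subst A g); last by rewrite msize_lin_subst.
  apply: lin_subst_gcd => //; case: g_gcd => g_div g_max; split=> [p /NE|h h_div].
    exact: g_div.
  by apply: g_max => p /NE; exact: h_div.
Qed.
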